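(* The Kapranov zeta function $$\zeta_{(Z,G)}(t)=1+\sum_{n=1}^\infty[(Z^n,G_n)]\,t^n$$ (for $G$-varieties $(Z,G)$, $G$ a finite group) defines a $\lambda$-structure on the ring $K_0^{\rm fGr}({\rm Var}_{\mathbb{C}})$; that is, it gives a well-defined additive-to-multiplicative homomorphism $a\mapsto\zeta_a(t)$ from $K_0^{\rm fGr}({\rm Var}_{\mathbb{C}})$ to $1+tK_0^{\rm fGr}({\rm Var}_{\mathbb{C}})[[t]]$ with $\zeta_a(t)=1+at+\ldots$ and $\zeta_{[(Z,G)]}(t)=\zeta_{(Z,G)}(t)$.
   Context: All varieties are complex quasi-projective varieties and all groups denoted $G,H,G_i,\dots$ are finite. $\lambda$-structure. For a commutative ring $R$ with unity, a $\lambda$-structure (called a pre-$\lambda$-structure in some terminology) is a map $R\to1+tR[[t]]$, $a\mapsto\lambda_a(t)$, with $\lambda_{a+b}(t)=\lambda_a(t)\lambda_b(t)$ and $\lambda_a(t)=1+at+\ldots$. Wreath products. For a $G$-variety $Z$, the Cartesian power $Z^n$ carries the natural action of the wreath product $G_n=G^n\rtimes S_n$, generated by the component-wise action of $G^n$ and the action of $S_n$ by permutations of the factors. The ring $K_0^{\rm fGr}({\rm Var}_{\mathbb{C}})$. A variety with a finite groups action is a variety $\mathcal X=\bigsqcup_{i=1}^s(X_i,G_i)$ represented as a finite disjoint union of locally closed subvarieties $X_i$ with left (algebraic) actions of finite groups $G_i$ (different in general). If $s=1$ it is called a variety with a pure action, or a $G$-variety, written $(Z,G)$. A partition of $\mathcal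 X$ consists of finite partitions of the components $X_i$ into locally closed $G_i$-invariant subvarieties (each piece carrying the group $G_i$). Varieties with pure actions $(Z,G)$, $(Z',G')$ are isomorphic if there are isomorphisms $\varphi:G\to G'$ of groups and $\psi:Z\to Z'$ of varieties with $\psi(gx)=\varphi(g)\psi(x)$. Two varieties with finite groups actions $\mathcal X,\mathcal Y$ are equivalent if they have partitions $\mathcal X=\bigsqcup_{i=1}^N(X_{(i)},G_{(i)})$, $\mathcal Y=\bigsqcup_{i=1}^N(Y_{(i)},G'_{(i)})$ with $(X_{(i)},G_{(i)})$ isomorphic to $(Y_{(i)},G'_{(i)})$ for all $i$. For a $G$-variety $Z$ and a finite group $H\supset G$, ${\rm ind}_G^H Z=(H\times Z)/\sim$, where $(h_1,x_1)\sim(h_2,x_2)$ iff there is $g\in G$ with $h_2=h_1g^{-1}$, $x_2=gx_1$; it carries the natural left $H$-action. $K_0^{\rm fGr}({\rm Var}_{\mathbb{C}})$ is the Abelian group generated by the classes $[\mathcal X]$ of varieties with finite groups actions modulo: (1) $[\mathcal X]=[\mathcal Y]$ if $\mathcal X$ and $\mathcal Y$ are equivalent; (2) $[\mathcal X]=[\mathcal Y]+[\mathcal X\setminus\mathcal Y]$ if $\mathcal Y$ is a Zariski closed subvariety of $\mathcal X$ invariant with respect to the groups actions; (3) $[({\rm ind}_G^HZ,H)]=[(Z,G)]$ for a $G$-variety $(Z,G)$ and a finite group $H\supset G$. Multiplication is induced by the Cartesian product: $[(Z_1,G_1)]\cdot[(Z_2,G_2)]=[(Z_1\times Z_2,G_1\times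 G_2)]$. As an Abelian group it is generated by the classes $[(Z,G)]$ of varieties with pure actions; the unit is the class of the one-point variety with the action of the trivial group. *)

(* Defs.v *)
From HB Require Import structures.
From mathcomp Require Import all_boot all_order all_algebra all_fingroup.
From mathcomp Require Import boolp mpoly.

Set Implicit Arguments.
Unset Strict Implicit.
Unset Printing Implicit Defensive.

Import GRing.Theory.
Local Open Scope ring_scope.

(* Quasi-projective varieties are classical ones: sets of closed points over  *)
(* an algebraically closed field K, locally closed in a projective space.     *)

Section Varieties.
Variable K : closedFieldType.

Definition ev N (p : {mpoly K[N]}) (v : 'rV[K]_N) : K := p.@[fun i => v 0 i].

Definition homogeneous N (p : {mpoly K[N]}) : Prop := exists d, p \is d.-homog.

Definition homogs N (A : {mpoly K[N]} -> Prop) : Prop :=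
  forall p, A p -> homogeneous p.

Definition zeros N (A : {mpoly K[N]} -> Prop) (v : 'rV[K]_N) : Prop :=
  forall p, A p -> ev p v = 0.

Lemma evM N (p q : {mpoly K[N]}) v : ev (p * q) v = ev p v * ev q v.
Proof. by rewrite /ev rmorphM. Qed.

Lemma evB N (p q : {mpoly K[N]}) v : ev (p - q) v = ev p v - ev q v.
Proof. by rewrite /ev rmorphB. Qed.

Lemma evX N i (v : 'rV[K]_N) : ev 'X_i v = v 0 i.
Proof. by rewrite /ev mevalXU. Qed.

Lemma ev1 N (v : 'rV[K]_N) : ev 1 v = 1.
Proof. by rewrite /ev rmorph1. Qed.

Lemma evZ N (p : {mpoly K[N]}) d c v :
  p \is d.-homog -> ev p (c *: v) = c ^+ d * ev p v.
Proof.
move=> /dhomogP hp; rewrite /ev !mevalE mulr_sumr !big_seq.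
apply: eq_bigr => m /hp <-; rewrite mulrCA; congr (_ * _).
rewrite /= mdegE -prodrXr -big_split /=; apply: eq_bigr => i _.
by rewrite mxE exprMn.
Qed.

Lemma evP N (p : {mpoly K[N]}) (v w : 'rV[K]_N) : v = w -> ev p v = ev p w.
Proof. by move->. Qed.

Definition msubst M N (F : 'I_M -> {mpoly K[N]}) (p : {mpoly K[M]}) :=
  p \mPo [tuple F i | i < M].

Lemma ev_subst M N (F : 'I_M -> {mpoly K[N]}) p v :
  ev (msubst F p) v = ev p (\row_i ev (F i) v).
Proof.
rewrite /ev /msubst comp_mpoly_meval; apply: mpoly.meval_eq => i.
by rewrite tnth_mktuple mxE.
Qed.

Lemma homog_subst M N (F : 'I_M -> {mpoly K[N]}) e d p :
  (forall i, F i \is e.-homog) -> p \is d.-homog ->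
  msubst F p \is (e * d).-homog.
Proof.
move=> hF /dhomogP hp; rewrite /msubst comp_mpolyE.
rewrite big_seq; apply: rpred_sum => m /hp <-.
apply: rpredZ; rewrite /= mdegE big_distrr /=.
elim: (index_enum _) => [|i s IH]; first by rewrite !big_nil dhomog1.
by rewrite !big_cons; apply: dhomogM => //; rewrite tnth_mktuple; apply: dhomogMn.
Qed.

Lemma homogX N i : ('X_i : {mpoly K[N]}) \is 1.-homog.
Proof. by rewrite dhomogX /= mdeg1. Qed.

Lemma homog1 N : homogeneous (1 : {mpoly K[N]}).
Proof. by exists 0%N; apply: dhomog1. Qed.

Lemma homogM N (p q : {mpoly K[N]}) :
  homogeneous p -> homogeneous q -> homogeneous (p * q).
Proof. by move=> [d hp] [e hq]; exists (d + e)%N; apply: dhomogM. Qed.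

Lemma zerosZ N (A : {mpoly K[N]} -> Prop) c v :
  homogs A -> c != 0 -> zeros A (c *: v) <-> zeros A v.
Proof.
move=> hA c0; split=> h p Ap; have [d hp] := hA p Ap; have := h p Ap.
  by rewrite (evZ _ _ hp) => /eqP; rewrite mulf_eq0 expf_eq0 (negPf c0) andbF => /eqP.
by rewrite (evZ _ _ hp) => ->; rewrite mulr0.
Qed.

Lemma nzerosP N (A : {mpoly K[N]} -> Prop) v :
  ~ zeros A v <-> exists2 p, A p & ev p v != 0.
Proof.
split=> [h|[p Ap /eqP np] h]; last by apply: np; apply: h.
apply: contrapT => h'; apply: h => p Ap; apply/eqP; apply: contrapT => /negP np.
by apply: h'; exists p.
Qed.

(* [h x] is a vector of homogeneous coordinates of the point x, and h         *)
(* identifies P with the locally closed subset V(A) \ V(B) of the projective  *)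
(* space P(K^N) of lines in K^N.                                              *)
Definition is_qp (T : Type) (P : T -> Prop) N (h : T -> 'rV[K]_N) : Prop :=
  [/\ forall x, P x -> h x != 0,
      forall x y c, P x -> P y -> h y = c *: h x -> x = y
    & exists A B : {mpoly K[N]} -> Prop, [/\ homogs A, homogs B
      & forall v, v != 0 ->
          (exists x c, P x /\ v = c *: h x) <-> zeros A v /\ ~ zeros B v]].

(* The variety is the subset [pts] of the type [pt]; the elements of [pt]      *)
(* outside of [pts] are junk.  Its Zariski topology, its locally closed       *)
(* subsets and its regular maps are read off the homogeneous coordinates, so  *)
(* they do not depend on the choice of the representatives [hc x].            *)
Record qpvar := QPVar {
  pt : Type;
  pts : pt -> Prop;
  amb : nat;
  hc : pt -> 'rV[K]_amb;
  qpvarP : is_qp pts hc }.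

Arguments pts {q} _.
Arguments hc {q} _.

Lemma hc_neq0 (X : qpvar) (x : pt X) : pts x -> hc x != 0.
Proof. by case: (qpvarP X) => h _ _; apply: h. Qed.

Lemma hc_inj (X : qpvar) (x y : pt X) c :
  pts x -> pts y -> hc y = c *: hc x -> x = y.
Proof. by case: (qpvarP X) => _ h _; apply: h. Qed.

Definition zclosed (X : qpvar) (S : pt X -> Prop) : Prop :=
  exists2 A : {mpoly K[amb X]} -> Prop,
    homogs A & forall x, pts x -> (S x <-> zeros A (hc x)).

Definition zopen (X : qpvar) (U : pt X -> Prop) : Prop :=
  zclosed (fun x => ~ U x).

(* Locally closed subsets. *)
Definition zlc (X : qpvar) (S : pt X -> Prop) : Prop :=
  exists F U, [/\ zclosed F, zopen U & forall x, pts x -> (S x <-> F x /\ U x)].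

(* Maps that are locally given by homogeneous polynomials of the same degree  *)
(* without common zero.                                                       *)
Definition regular (X Y : qpvar) (f : pt X -> pt Y) : Prop :=
  (forall x, pts x -> pts (f x)) /\
  forall x, pts x -> exists U : pt X -> Prop, [/\ zopen U, U x &
    exists d (F : 'I_(amb Y) -> {mpoly K[amb X]}),
      (forall j, F j \is d.-homog) /\
      forall y, pts y -> U y ->
        exists2 c, c != 0 & \row_j ev (F j) (hc y) = c *: hc (f y)].

Lemma zopenP (X : qpvar) (U : pt X -> Prop) :
  zopen U <-> forall x, pts x -> U x -> exists r : {mpoly K[amb X]},
    [/\ homogeneous r, ev r (hc x) != 0
      & forall y, pts y -> ev r (hc y) != 0 -> U y].
Proof.
split=> [[A hA AU] x Px Ux|h].
  have /nzerosP [p Ap np] : ~ zeros A (hc x) by move/(AU x Px).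
  exists p; split=> //; first exact: hA.
  move=> y Py /eqP ny; apply: contrapT => /(AU y Py) z.
  by apply: ny; apply: z.
exists (fun r => homogeneous r /\ forall y, pts y -> ev r (hc y) != 0 -> U y).
  by move=> p [].
move=> x Px; split=> [nU r [_ rU]|z Ux].
  by apply/eqP; apply: contrapT => /negP /(rU x Px).
have [r [hr nr rU]] := h x Px Ux.
by move/eqP: nr; apply; apply: z.
Qed.

Lemma zopen_ext (X : qpvar) (U V : pt X -> Prop) :
  (forall x, pts x -> (U x <-> V x)) -> zopen U -> zopen V.
Proof.
move=> UV [A hA AU]; exists A => // x Px; rewrite -(AU x Px).
by have := UV x Px; tauto.
Qed.

Lemma zopenI (X : qpvar) (U V : pt X -> Prop) :
  zopen U -> zopen V -> zopen (fun x => U x /\ V x).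
Proof.
move=> /zopenP hU /zopenP hV; apply/zopenP => x Px [/(hU x Px)[r [hr nr rU]]].
move=> /(hV x Px)[s [hs ns sV]]; exists (r * s); split; first exact: homogM.
  by rewrite evM mulf_neq0.
move=> y Py; rewrite evM mulf_eq0 negb_or => /andP[ry sy].
by split; [apply: rU|apply: sV].
Qed.

Lemma zopenT (X : qpvar) : zopen (fun _ : pt X => True).
Proof.
apply/zopenP => x Px _; exists 1; split=> //; first exact: homog1.
by rewrite ev1 oner_neq0.
Qed.

Lemma zclosed_openC (X : qpvar) (S : pt X -> Prop) :
  zclosed S <-> zopen (fun x => ~ S x).
Proof.
by split=> -[A hA AS]; exists A => // x Px; rewrite -(AS x Px) not_notE.
Qed.

Lemma regular_cont (X Y : qpvar) (f : pt X -> pt Y) V :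
  regular f -> zopen V -> zopen (fun x => V (f x)).
Proof.
move=> [fP hf] /zopenP hV; apply/zopenP => x Px Vx.
have [U [/zopenP hU Ux [d [F [hF eF]]]]] := hf x Px.
have [r [hr nr rU]] := hU x Px Ux.
have [s [[e hs] ns sV]] := hV _ (fP x Px) Vx.
have key y : pts y -> U y ->
    exists2 c, c != 0 & ev (msubst F s) (hc y) = c * ev s (hc (f y)).
  move=> Py Uy; have [c c0 ec] := eF y Py Uy.
  by exists (c ^+ e); [rewrite expf_neq0|rewrite ev_subst ec (evZ _ _ hs)].
exists (r * msubst F s); split.
- by apply: homogM => //; exists (d * e)%N; apply: homog_subst.
- by have [c c0 ec] := key x Px Ux; rewrite evM ec !mulf_neq0.
move=> y Py; rewrite evM mulf_eq0 negb_or => /andP[/(rU y Py) Uy].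
have [c c0 ->] := key y Py Uy; rewrite mulf_eq0 negb_or => /andP[_].
by apply: sV; apply: fP.
Qed.

Lemma regular_comp (X Y Z : qpvar) (f : pt X -> pt Y) (g : pt Y -> pt Z) :
  regular f -> regular g -> regular (fun x => g (f x)).
Proof.
move=> rf rg; have [fP hf] := rf; have [gP hg] := rg.
split=> [x Px|x Px]; first by apply/gP/fP.
have [U [oU Ux [d [F [hF eF]]]]] := hf x Px.
have [V [oV Vx [e [G [hG eG]]]]] := hg _ (fP x Px).
exists (fun y => U y /\ V (f y)); split=> //.
  by apply: zopenI => //; apply: regular_cont oV.
exists (d * e)%N, (fun j => msubst F (G j)); split=> [j|y Py [Uy Vy]].
  exact: homog_subst.
have [c c0 ec] := eF y Py Uy; have [c' c'0 ec'] := eG _ (fP y Py) Vy.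
exists (c ^+ e * c'); first by rewrite mulf_neq0 ?expf_neq0.
apply/rowP => j; rewrite mxE ev_subst ec (evZ _ _ (hG j)).
by have /rowP/(_ j) := ec'; rewrite !mxE => ->; rewrite mulrA.
Qed.

Lemma regular_local (X Y : qpvar) (f : pt X -> pt Y) :
  (forall x, pts x -> exists U (g : pt X -> pt Y),
     [/\ zopen U, U x, regular g & forall y, pts y -> U y -> f y = g y]) ->
  regular f.
Proof.
move=> h; split=> [x Px|x Px]; have [U [g [oU Ux [gP hg] fg]]] := h x Px.
  by rewrite fg //; apply: gP.
have [V [oV Vx [d [F [hF eF]]]]] := hg x Px.
exists (fun y => U y /\ V y); split=> //; first exact: zopenI.
by exists d, F; split=> // y Py [Uy Vy]; rewrite fg //; apply: eF.
Qed.

Lemma regular_ext (X Y : qpvar) (f g : pt X -> pt Y) :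
  (forall x, pts x -> f x = g x) -> regular g -> regular f.
Proof.
move=> fg rg; apply: regular_local => x Px; exists (fun=> True), g.
by split=> //; [exact: zopenT|move=> y Py _; apply: fg].
Qed.

Lemma regular_id (X : qpvar) : regular (fun x : pt X => x).
Proof.
split=> // x Px; exists (fun=> True); split=> //; first exact: zopenT.
exists 1%N, (fun i => 'X_i); split=> [j|y Py _]; first exact: homogX.
exists 1; first exact: oner_neq0.
by apply/rowP => j; rewrite !mxE evX mul1r.
Qed.

Lemma zclosed_pre (X Y : qpvar) (f : pt X -> pt Y) S :
  regular f -> zclosed S -> zclosed (fun x => S (f x)).
Proof. by rewrite !zclosed_openC => rf; apply: regular_cont. Qed.

Lemma zclosedI (X : qpvar) (S T : pt X -> Prop) :
  zclosed S -> zclosed T -> zclosed (fun x => S x /\ T x).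
Proof.
move=> [A hA AS] [B hB BT]; exists (fun p => A p \/ B p).
  by move=> p [/hA|/hB].
move=> x Px; rewrite (AS x Px) (BT x Px); split=> [[zA zB] p [/zA|/zB]//|z].
by split=> p h; apply: z; [left|right].
Qed.

Lemma zclosed_lc (X : qpvar) (S : pt X -> Prop) : zclosed S -> zlc S.
Proof.
by move=> cS; exists S, (fun=> True); split=> //; [exact: zopenT|tauto].
Qed.

Lemma zclosedT (X : qpvar) : zclosed (fun _ : pt X => True).
Proof. by exists (fun=> False) => [p []|x _]; split=> // _ p []. Qed.

Lemma zopen_lc (X : qpvar) (S : pt X -> Prop) : zopen S -> zlc S.
Proof.
by move=> cS; exists (fun=> True), S; split=> //; [exact: zclosedT|tauto].
Qed.

Lemma zlcI (X : qpvar) (S T : pt X -> Prop) :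
  zlc S -> zlc T -> zlc (fun x => S x /\ T x).
Proof.
move=> [F [U [cF oU hS]]] [G [V [cG oV hT]]].
exists (fun x => F x /\ G x), (fun x => U x /\ V x); split.
- exact: zclosedI.
- exact: zopenI.
by move=> x Px; rewrite (hS x Px) (hT x Px); tauto.
Qed.

Lemma zlc_pre (X Y : qpvar) (f : pt X -> pt Y) S :
  regular f -> zlc S -> zlc (fun x => S (f x)).
Proof.
move=> rf [F [U [cF oU hS]]].
exists (fun x => F (f x)), (fun x => U (f x)); split.
- exact: zclosed_pre.
- exact: regular_cont oU.
by move=> x Px; apply: hS; apply: (proj1 rf).
Qed.

Lemma zlc_ext (X : qpvar) (S T : pt X -> Prop) :
  (forall x, pts x -> (S x <-> T x)) -> zlc S -> zlc T.
Proof.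
move=> ST [F [U [cF oU hS]]]; exists F, U; split=> // x Px.
by rewrite -(ST x Px); apply: hS.
Qed.

Lemma zlcT (X : qpvar) : zlc (fun _ : pt X => True).
Proof. by apply: zopen_lc; apply: zopenT. Qed.

Lemma sub_qp (X : qpvar) (S : pt X -> Prop) :
  zlc S -> is_qp (fun x => pts x /\ S x) (@hc X).
Proof.
move=> [F [U [[A1 hA1 AF] [B1 hB1 BU] hS]]].
case: (qpvarP X) => X0 Xinj [A [B [hA hB AB]]].
split=> [x [Px _]|x y c [Px _] [Py _]|]; [exact: X0|exact: Xinj|].
exists (fun p => A p \/ A1 p), (fun p => exists q r, [/\ B q, B1 r & p = q * r]).
split=> [p [/hA|/hA1] //|p [q [r [/hB hq /hB1 hr ->]]]|v v0]; first exact: homogM.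
split=> [[x [c [[Px Sx] ev_]]]|[zA nzB]].
  have c0 : c != 0 by apply: contraNneq v0 => c0; rewrite ev_ c0 scale0r.
  have [Fx Ux] := (hS x Px).1 Sx.
  have [zA nzB] : zeros A v /\ ~ zeros B v by apply/(AB v v0); exists x, c.
  split=> [p [/zA //|A1p]|].
    by move: p A1p; rewrite ev_; apply/(zerosZ _ hA1 c0)/(AF x Px).
  have [q Bq nq] := (nzerosP _ _).1 nzB.
  have : ~ zeros B1 (hc x) by move/(BU x Px).
  rewrite -(zerosZ _ hB1 c0) -ev_ => /nzerosP[r B1r nr].
  by apply/nzerosP; exists (q * r); [exists q, r|rewrite evM mulf_neq0].
have [_ [q [r [Bq B1r ->]]]] := (nzerosP _ _).1 nzB.
rewrite evM mulf_eq0 negb_or => /andP[nq nr].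
have [x [c [Px ev_]]] : exists x c, pts x /\ v = c *: hc x.
  by apply/(AB v v0); split; [move=> p Ap; apply: zA; left|apply/nzerosP; exists q].
have c0 : c != 0 by apply: contraNneq v0 => c0; rewrite ev_ c0 scale0r.
exists x, c; split=> //; split=> //; apply/(hS x Px); split.
  apply/(AF x Px)/(zerosZ _ hA1 c0); rewrite -ev_ => p A1p; apply: zA; by right.
apply: contrapT => /(BU x Px)/(zerosZ _ hB1 c0); rewrite -ev_ => z.
by move/eqP: nr; apply; apply: z.
Qed.

Definition subvar (X : qpvar) (S : pt X -> Prop) (lcS : zlc S) : qpvar :=
  QPVar (sub_qp lcS).

Lemma zclosed_sub (X : qpvar) (S : pt X -> Prop) (lcS : zlc S) (T : pt X -> Prop) :
  zclosed T -> zclosed (T : pt (subvar lcS) -> Prop).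
Proof. by move=> [A hA AT]; exists A => // x [Px _]; apply: AT. Qed.

Lemma zopen_sub (X : qpvar) (S : pt X -> Prop) (lcS : zlc S) (T : pt X -> Prop) :
  zopen T -> zopen (T : pt (subvar lcS) -> Prop).
Proof. exact: zclosed_sub. Qed.

Lemma zlc_sub (X : qpvar) (S : pt X -> Prop) (lcS : zlc S) (T : pt X -> Prop) :
  zlc T -> zlc (T : pt (subvar lcS) -> Prop).
Proof.
move=> [F [U [cF oU hT]]]; exists F, U.
by split=> [||x [Px _]]; [exact: zclosed_sub|exact: zopen_sub|exact: hT].
Qed.

Lemma regular_from_sub (X Y : qpvar) (S : pt X -> Prop) (lcS : zlc S)
    (f : pt X -> pt Y) :
  regular f -> @regular (subvar lcS) Y f.
Proof.
move=> [fP hf]; split=> [x [Px _]|x [Px _]]; first exact: fP.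
have [U [oU Ux [d [F [hF eF]]]]] := hf x Px.
exists U; split=> //; first exact: zopen_sub.
by exists d, F; split=> // y [Py _]; apply: eF.
Qed.

Lemma regular_to_sub (X Y : qpvar) (S : pt Y -> Prop) (lcS : zlc S)
    (f : pt X -> pt Y) :
  regular f -> (forall x, pts x -> S (f x)) -> @regular X (subvar lcS) f.
Proof. by move=> [fP hf] fS; split=> // x Px; split; [apply: fP|apply: fS]. Qed.

Lemma regular_of_sub (X Y : qpvar) (S : pt Y -> Prop) (lcS : zlc S)
    (f : pt X -> pt Y) :
  @regular X (subvar lcS) f -> regular f.
Proof. by move=> [fP hf]; split=> // x /fP[]. Qed.

Definition segre N M (u : 'rV[K]_N) (v : 'rV[K]_M) : 'rV[K]_(N * M) :=
  mxvec (u^T *m v).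

Lemma segreE N M (u : 'rV[K]_N) (v : 'rV[K]_M) i j :
  segre u v 0 (mxvec_index i j) = u 0 i * v 0 j.
Proof. by rewrite /segre mxvecE mxE big_ord1 mxE. Qed.

Lemma rV_neq0P N (v : 'rV[K]_N) : v != 0 -> exists i, v 0 i != 0.
Proof.
move=> v0; apply: contrapT => h; move/eqP: v0; apply; apply/rowP => i.
by rewrite mxE; apply/eqP; apply: contrapT => /negP ni; apply: h; exists i.
Qed.

Lemma segre_neq0 N M (u : 'rV[K]_N) (v : 'rV[K]_M) :
  u != 0 -> v != 0 -> segre u v != 0.
Proof.
move=> /rV_neq0P[i ui] /rV_neq0P[j vj]; apply/eqP => /rowP/(_ (mxvec_index i j)).
by rewrite segreE mxE => /eqP; rewrite mulf_eq0 (negPf ui) (negPf vj).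
Qed.

Definition colp N M (j : 'I_M) (p : {mpoly K[N]}) : {mpoly K[N * M]} :=
  msubst (fun i => 'X_(mxvec_index i j)) p.
Definition rowp N M (i : 'I_N) (p : {mpoly K[M]}) : {mpoly K[N * M]} :=
  msubst (fun j => 'X_(mxvec_index i j)) p.

Lemma ev_colp N M (j : 'I_M) (p : {mpoly K[N]}) w :
  ev (colp j p) w = ev p (\row_i w 0 (mxvec_index i j)).
Proof. by rewrite ev_subst; apply: evP; apply/rowP => i; rewrite !mxE evX. Qed.

Lemma ev_rowp N M (i : 'I_N) (p : {mpoly K[M]}) w :
  ev (rowp i p) w = ev p (\row_j w 0 (mxvec_index i j)).
Proof. by rewrite ev_subst; apply: evP; apply/rowP => j; rewrite !mxE evX. Qed.

Lemma homog_subX N M (s : 'I_M -> 'I_N) (p : {mpoly K[M]}) :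
  homogeneous p -> homogeneous (msubst (fun i => 'X_(s i)) p).
Proof.
by move=> [d hp]; exists (1 * d)%N; apply: homog_subst => // i; apply: homogX.
Qed.

Lemma prod_qp (T T' : Type) (P : T -> Prop) (P' : T' -> Prop) N M
    (h : T -> 'rV[K]_N) (h' : T' -> 'rV[K]_M) :
  is_qp P h -> is_qp P' h' ->
  is_qp (fun z : T * T' => P z.1 /\ P' z.2) (fun z => segre (h z.1) (h' z.2)).
Proof.
move=> [h0 hinj [A1 [B1 [hA1 hB1 AB1]]]] [h'0 h'inj [A2 [B2 [hA2 hB2 AB2]]]].
split.
- by move=> [x y] /= [Px Py]; apply: segre_neq0; [apply: h0|apply: h'0].
- move=> [x y] [x' y'] c /= [Px Py] [Px' Py'] e.
  have E i j : h x' 0 i * h' y' 0 j = c * (h x 0 i * h' y 0 j).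
    by have /rowP/(_ (mxvec_index i j)) := e; rewrite segreE mxE segreE.
  congr (_, _).
    have [j nj] := rV_neq0P (h'0 _ Py').
    apply: (hinj _ _ (c * h' y 0 j / h' y' 0 j)) => //; apply/rowP => i.
    rewrite mxE; apply: (mulIf nj); rewrite E.
    by rewrite [RHS]mulrAC mulfVK // -mulrA [h' y 0 j * _]mulrC.
  have [i ni] := rV_neq0P (h0 _ Px').
  apply: (h'inj _ _ (c * h x 0 i / h x' 0 i)) => //; apply/rowP => j.
  by rewrite mxE; apply: (mulfI ni); rewrite E [RHS]mulrA [X in _ = X * _]mulrC mulfVK // mulrA.
pose minor i k j l : {mpoly K[N * M]} :=
  'X_(mxvec_index i j) * 'X_(mxvec_index k l)
  - 'X_(mxvec_index i l) * 'X_(mxvec_index k j).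
exists (fun p => [\/ exists i k j l, p = minor i k j l,
                     exists j q, A1 q /\ p = colp j q
                   | exists i q, A2 q /\ p = rowp i q]).
exists (fun p => exists i j q r, [/\ B1 q, B2 r & p = colp j q * rowp i r]).
split.
- move=> p [[i [k [j [l ->]]]]|[j [q [/hA1 hq ->]]]|[i [q [/hA2 hq ->]]]].
  + by exists (1 + 1)%N; apply: rpredB; apply: dhomogM; apply: homogX.
  + exact: homog_subX.
  + exact: homog_subX.
- move=> p [i [j [q [r [/hB1 hq /hB2 hr ->]]]]].
  by apply: homogM; apply: homog_subX.
move=> w w0; split=> [[[x y] [c [/= [Px Py] ew]]]|[zA nzB]].
  have E i j : w 0 (mxvec_index i j) = c * (h x 0 i * h' y 0 j).
    by rewrite ew mxE segreE.
  have c0 : c != 0 by apply: contraNneq w0 => c0; rewrite ew c0 scale0r.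
  have Ec j : \row_i w 0 (mxvec_index i j) = (c * h' y 0 j) *: h x.
    by apply/rowP => i; rewrite !mxE E mulrCA mulrC mulrAC.
  have Er i : \row_j w 0 (mxvec_index i j) = (c * h x 0 i) *: h' y.
    by apply/rowP => j; rewrite !mxE E mulrA.
  have [z1 nz1] : zeros A1 (h x) /\ ~ zeros B1 (h x).
    by apply/AB1; [exact: h0|exists x, 1; rewrite scale1r].
  have [z2 nz2] : zeros A2 (h' y) /\ ~ zeros B2 (h' y).
    by apply/AB2; [exact: h'0|exists y, 1; rewrite scale1r].
  split.
    move=> p [[i [k [j [l ->]]]]|[j [q [A1q ->]]]|[i [q [A2q ->]]]].
    + by rewrite evB !evM !evX !E; apply/eqP; rewrite subr_eq0; apply/eqP;
        rewrite mulrACA [RHS]mulrACA; congr (_ * _);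
        rewrite mulrACA [RHS]mulrACA; congr (_ * _); rewrite mulrC.
    + by have [d hq] := hA1 _ A1q; rewrite ev_colp Ec (evZ _ _ hq) z1 ?mulr0.
    + by have [d hq] := hA2 _ A2q; rewrite ev_rowp Er (evZ _ _ hq) z2 ?mulr0.
  have [q B1q nq] := (nzerosP _ _).1 nz1; have [r B2r nr] := (nzerosP _ _).1 nz2.
  have [j nj] := rV_neq0P (h'0 _ Py); have [i ni] := rV_neq0P (h0 _ Px).
  apply/nzerosP; exists (colp j q * rowp i r); first by exists i, j, q, r.
  have [d hq] := hB1 _ B1q; have [e hr] := hB2 _ B2r.
  rewrite evM ev_colp ev_rowp Ec Er (evZ _ _ hq) (evZ _ _ hr).
  by rewrite !mulf_neq0 // expf_neq0 // mulf_neq0.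
have [kl nkl] := rV_neq0P w0; move: nkl; case/mxvec_indexP: kl => k l nkl.
set u := \row_i w 0 (mxvec_index i l); set v := \row_j w 0 (mxvec_index k j).
have u0 : u != 0.
  by apply: contraNneq nkl => /rowP/(_ k); rewrite !mxE => ->.
have v0 : v != 0.
  by apply: contraNneq nkl => /rowP/(_ l); rewrite !mxE => ->.
set a := w 0 (mxvec_index k l).
have E i j : w 0 (mxvec_index i j) * a = u 0 i * v 0 j.
  have := zA (minor i k j l); rewrite evB !evM !evX => e; rewrite !mxE.
  by apply/eqP; rewrite -subr_eq0; apply/eqP; apply: e; constructor 1; exists i, k, j, l.
have Ec j : \row_i w 0 (mxvec_index i j) = (v 0 j / a) *: u.
  by apply/rowP => i; rewrite mxE [RHS]mxE; apply: (mulIf nkl); rewrite -/a E mulrAC mulfVK // mulrC.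
have Er i : \row_j w 0 (mxvec_index i j) = (u 0 i / a) *: v.
  by apply/rowP => j; rewrite mxE [RHS]mxE; apply: (mulIf nkl); rewrite -/a E mulrAC mulfVK.
have [_ [i [j [q [r [B1q B2r ->]]]]]] := (nzerosP _ _).1 nzB.
rewrite evM ev_colp ev_rowp mulf_eq0 negb_or Ec Er => /andP[nq nr].
have [x [c [Px ex]]] : exists x c, P x /\ u = c *: h x.
  apply/AB1 => //; split=> [p A1p|].
    by rewrite -(ev_colp l p w); apply: zA; constructor 2; exists l, p.
  apply/nzerosP; exists q => //; have [d hq] := hB1 _ B1q.
  by apply: contraNneq nq => e; rewrite (evZ _ _ hq) e mulr0.
have [y [c' [Py ey]]] : exists y c, P' y /\ v = c *: h' y.
  apply/AB2 => //; split=> [p A2p|].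
    by rewrite -(ev_rowp k p w); apply: zA; constructor 3; exists k, p.
  apply/nzerosP; exists r => //; have [d hr] := hB2 _ B2r.
  by apply: contraNneq nr => e; rewrite (evZ _ _ hr) e mulr0.
exists (x, y), (c * c' / a); split=> //; apply/rowP => ij.
case/mxvec_indexP: ij => i' j'; rewrite mxE segreE; apply: (mulIf nkl).
by rewrite -/a E ex ey !mxE [RHS]mulrAC mulfVK // mulrACA.
Qed.

Definition prodvar (X Y : qpvar) : qpvar := QPVar (prod_qp (qpvarP X) (qpvarP Y)).

Lemma regular_fst (X Y : qpvar) : @regular (prodvar X Y) X fst.
Proof.
split=> [x []|[x y] [/= Px Py]] //.
have [j nj] := rV_neq0P (hc_neq0 Py).
exists (fun z => hc z.2 0 j != 0); split=> //.
  apply/zopenP => -[x' y'] [/= Px' Py'] nj'.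
  have [i ni] := rV_neq0P (hc_neq0 Px').
  exists 'X_(mxvec_index i j); split; first by exists 1%N; apply: homogX.
    by rewrite evX segreE mulf_neq0.
  by move=> [x2 y2] _; rewrite evX segreE mulf_eq0 negb_or => /andP[].
exists 1%N, (fun i => 'X_(mxvec_index i j)); split=> [i|]; first exact: homogX.
move=> [x' y'] _ /= nj'; exists (hc y' 0 j) => //; apply/rowP => i.
by rewrite !mxE evX segreE mulrC.
Qed.

Lemma regular_snd (X Y : qpvar) : @regular (prodvar X Y) Y snd.
Proof.
split=> [x []|[x y] [/= Px Py]] //.
have [i ni] := rV_neq0P (hc_neq0 Px).
exists (fun z => hc z.1 0 i != 0); split=> //.
  apply/zopenP => -[x' y'] [/= Px' Py'] ni'.
  have [j nj] := rV_neq0P (hc_neq0 Py').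
  exists 'X_(mxvec_index i j); split; first by exists 1%N; apply: homogX.
    by rewrite evX segreE mulf_neq0.
  by move=> [x2 y2] _; rewrite evX segreE mulf_eq0 negb_or => /andP[].
exists 1%N, (fun j => 'X_(mxvec_index i j)); split=> [j|]; first exact: homogX.
move=> [x' y'] _ /= ni'; exists (hc x' 0 i) => //; apply/rowP => j.
by rewrite !mxE evX segreE.
Qed.

Lemma regular_pair (W X Y : qpvar) (f : pt W -> pt X) (g : pt W -> pt Y) :
  regular f -> regular g -> @regular W (prodvar X Y) (fun w => (f w, g w)).
Proof.
move=> [fP hf] [gP hg]; split=> [w Pw|w Pw]; first by split; [apply: fP|apply: gP].
have [U [oU Ux [d [F [hF eF]]]]] := hf w Pw.
have [V [oV Vx [e [G [hG eG]]]]] := hg w Pw.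
exists (fun y => U y /\ V y); split=> //; first exact: zopenI.
exists (d + e)%N, (fun k => mxvec (\matrix_(i, j) (F i * G j)) 0 k); split.
  by move=> k; case/mxvec_indexP: k => i j; rewrite mxvecE mxE; apply: dhomogM.
move=> y Py [Uy Vy]; have [c c0 ec] := eF y Py Uy; have [b b0 eb] := eG y Py Vy.
exists (c * b); first by rewrite mulf_neq0.
apply/rowP => k; case/mxvec_indexP: k => i j.
rewrite mxE mxvecE mxE evM [RHS]mxE segreE /= mulrACA.
by move/rowP: ec => /(_ i); move/rowP: eb => /(_ j); rewrite !mxE => -> ->.
Qed.

Lemma zlc_prod (X Y : qpvar) (S : pt X -> Prop) (T : pt Y -> Prop) :
  zlc S -> zlc T -> zlc (fun z : pt (prodvar X Y) => S z.1 /\ T z.2).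
Proof.
by move=> lS lT; apply: zlcI;
  [apply: (zlc_pre (regular_fst X Y))|apply: (zlc_pre (regular_snd X Y))].
Qed.

Lemma fin_qp (T : finType) :
  is_qp (fun _ : T => True)
    (fun t => delta_mx 0 (enum_rank t) : 'rV[K]_#|T|).
Proof.
split=> [t _|s t c _ _ /rowP/(_ (enum_rank t))|].
- by apply/eqP => /rowP/(_ (enum_rank t)); rewrite !mxE !eqxx /= => /eqP; rewrite oner_eq0.
- rewrite !mxE !eqxx /=; case: eqP => [/enum_rank_inj //|_] /eqP.
  by rewrite mulr0 oner_eq0.
exists (fun p => exists i j, i != j /\ p = 'X_i * 'X_j), (fun p => p = 1).
split=> [p [i [j [_ ->]]]|p ->|v v0].
- by exists (1 + 1)%N; apply: dhomogM; apply: homogX.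
- exact: homog1.
split=> [[t [c [_ ->]]]|[z _]].
  split=> [_ [i [j [ij ->]]]|]; last first.
    by apply/nzerosP; exists 1 => //; rewrite ev1 oner_neq0.
  rewrite evM !evX !mxE eqxx /=; case: eqP => [it|_]; last by rewrite mulr0 mul0r.
  by case: eqP => [jt|_]; [move: ij; rewrite it jt eqxx|rewrite !mulr0].
have [i ni] := rV_neq0P v0; exists (enum_val i), (v 0 i); split=> //.
apply/rowP => j; rewrite !mxE eqxx enum_valK /=.
case: eqP => [-> |/eqP ij]; first by rewrite mulr1.
have /eqP := z ('X_j * 'X_i) (ex_intro _ j (ex_intro _ i (conj ij erefl))).
by rewrite evM !evX mulf_eq0 (negPf ni) orbF mulr0 => /eqP.
Qed.

(* The variety with set of points T: the coordinate points of P(K^#|T|). *)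
Definition finvar (T : finType) : qpvar := QPVar (fin_qp T).

Lemma zopen_fin (T : finType) (U : T -> Prop) : zopen (U : pt (finvar T) -> Prop).
Proof.
apply/zopenP => t _ Ut; exists 'X_(enum_rank t); split.
- by exists 1%N; apply: homogX.
- by rewrite evX mxE !eqxx oner_neq0.
move=> s _; rewrite evX mxE eqxx /=; case: (enum_rank t =P _) => [/enum_rank_inj <- //|_].
by rewrite eqxx.
Qed.

Lemma regular_finprod (T : finType) (X Y : qpvar) (f : T -> pt X -> pt Y) :
  (forall t, regular (f t)) ->
  @regular (prodvar (finvar T) X) Y (fun z => f z.1 z.2).
Proof.
move=> hf; apply: regular_local => -[t x] [_ Px].
exists (fun z => z.1 = t), (fun z => f t z.2); split=> //.
- by apply: (regular_cont (regular_fst _ _) (zopen_fin (fun s => s = t))).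
- exact: (regular_comp (regular_snd _ _) (hf t)).
by move=> [s y] _ /= ->.
Qed.

Lemma regular_finconst (T : finType) (X : qpvar) (t : T) :
  @regular X (finvar T) (fun=> t).
Proof.
split=> // x Px; exists (fun=> True); split=> //; first exact: zopenT.
exists 0%N, (fun i => (i == enum_rank t)%:R); split=> [i|y _ _].
  by case: eqP => _; [exact: dhomog1|exact: dhomog0].
exists 1; first exact: oner_neq0.
apply/rowP => i; rewrite !mxE eqxx mul1r /=.
by case: eqP => _; rewrite ?ev1 // /ev meval0.
Qed.

Fixpoint powamb (N n : nat) : nat := if n is n'.+1 then (N * powamb N n')%N else 1%N.

Fixpoint powhc (T : Type) N (h : T -> 'rV[K]_N) n :
    ('I_n -> T) -> 'rV[K]_(powamb N n) :=
  match n with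
  | 0 => fun _ => const_mx 1
  | n'.+1 => fun x => segre (h (x ord0)) (powhc h (fun i => x (lift ord0 i)))
  end.

Lemma pull_qp (T T' : Type) (P : T' -> Prop) N (h : T' -> 'rV[K]_N)
    (f : T -> T') (g : T' -> T) : cancel f g -> cancel g f ->
  is_qp P h -> is_qp (fun x => P (f x)) (fun x => h (f x)).
Proof.
move=> fK gK [h0 hinj [A [B [hA hB AB]]]]; split=> [x Px|x y c Px Py e|].
- exact: h0.
- by apply: (can_inj fK); apply: hinj e.
exists A, B; split=> // v v0; rewrite -(AB v v0); split.
  by move=> [x [c ?]]; exists (f x), c.
by move=> [x [c ?]]; exists (g x), c; rewrite gK.
Qed.

Lemma eq_qp (T : Type) (P Q : T -> Prop) N (h : T -> 'rV[K]_N) :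
  (forall x, P x <-> Q x) -> is_qp P h -> is_qp Q h.
Proof. by move=> PQ; have -> : P = Q by apply: funext => x; apply/propext. Qed.

Definition fcons (T : Type) n (z : T * ('I_n -> T)) : 'I_n.+1 -> T :=
  fun i => if unlift ord0 i is Some j then z.2 j else z.1.

Lemma pow_qp (T : Type) (P : T -> Prop) N (h : T -> 'rV[K]_N) n :
  is_qp P h -> is_qp (fun x : 'I_n -> T => forall i, P (x i)) (powhc h (n := n)).
Proof.
move=> hP; elim: n => [|n IH].
  split=> [x _|x y c _ _ _|].
  - by apply/eqP => /rowP/(_ 0); rewrite !mxE => /eqP; rewrite oner_eq0.
  - by apply: funext => -[].
  exists (fun=> False), (fun p => p = 1); split=> [//|p ->|v v0].
    exact: homog1.
  split=> [_|_].
    by split=> //; apply/nzerosP; exists 1 => //; rewrite ev1 oner_neq0.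
  have x0 : 'I_0 -> T by case.
  exists x0, (v 0 0); split; first by case.
  by apply/rowP => i; rewrite !mxE mulr1 ord1.
pose f (x : 'I_n.+1 -> T) := (x ord0, fun i => x (lift ord0 i)).
have fK : cancel f (@fcons T n).
  by move=> x; apply: funext => i; rewrite /f /fcons; case: unliftP => [j|] -> //=.
have gK : cancel (@fcons T n) f.
  move=> [a x]; rewrite /f /fcons /= unlift_none; congr (_, _).
  by apply: funext => i; rewrite liftK.
apply: eq_qp (pull_qp fK gK (prod_qp hP IH)) => x; split=> [[Px0 Px] i|Px].
  by case: (unliftP ord0 i) => [j|] ->; [apply: Px|apply: Px0].
by split=> [|i]; apply: Px.
Qed.

(* The Cartesian power, embedded by iterated Segre embeddings. *)
Definition powvar (X : qpvar) (n : nat) : qpvar := QPVar (pow_qp n (qpvarP X)).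

Lemma regular_powcons (X : qpvar) n :
  @regular (powvar X n.+1) (prodvar X (powvar X n))
    (fun x => (x ord0, fun i => x (lift ord0 i))).
Proof.
split=> [x Px|x Px]; first by split=> [|i]; apply: Px.
exists (fun=> True); split=> //; first exact: zopenT.
exists 1%N, (fun i => 'X_i); split=> [j|y Py _]; first exact: homogX.
exists 1; first exact: oner_neq0.
by apply/rowP => j; rewrite !mxE evX mul1r.
Qed.

Lemma regular_powuncons (X : qpvar) n :
  @regular (prodvar X (powvar X n)) (powvar X n.+1) (@fcons (pt X) n).
Proof.
split=> [[a x] [/= Pa Px] i|[a x] Px].
  by rewrite /fcons; case: unliftP => /=.
exists (fun=> True); split=> //; first exact: zopenT.
exists 1%N, (fun i => 'X_i); split=> [j|[b y] Py _]; first exact: homogX.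
exists 1; first exact: oner_neq0.
apply/rowP => j; rewrite !mxE evX mul1r /= /fcons unlift_none /=.
do 2 f_equal; congr powhc; apply: funext => i; by rewrite liftK.
Qed.

Lemma regular_proj (X : qpvar) n (i : 'I_n) :
  @regular (powvar X n) X (fun x => x i).
Proof.
elim: n i => [[]//|n IH] i; case: (unliftP ord0 i) => [j|] ->.
  exact: (regular_comp (regular_comp (regular_powcons _ _) (regular_snd _ _)) (IH j)).
exact: (regular_comp (regular_powcons _ _) (regular_fst _ _)).
Qed.

Lemma regular_tuple (W X : qpvar) n (f : 'I_n -> pt W -> pt X) :
  (forall i, regular (f i)) -> @regular W (powvar X n) (fun w i => f i w).
Proof.
elim: n f => [|n IH] f hf.
  split=> [w Pw [] //|w Pw]; exists (fun=> True); split=> //; first exact: zopenT.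
  exists 0%N, (fun i => 1); split=> [i|y _ _]; first exact: dhomog1.
  exists 1; first exact: oner_neq0.
  by apply/rowP => i; rewrite !mxE ev1 mulr1.
have := regular_comp (regular_pair (hf ord0) (IH _ (fun i => hf (lift ord0 i))))
  (regular_powuncons X n).
apply: regular_ext => w _; apply: funext => i; rewrite /fcons.
by case: unliftP => [j|] ->.
Qed.

Record gaction (G : finGroupType) (X : qpvar) := GAction {
  act :> G -> pt X -> pt X;
  act_regular : forall g, regular (act g);
  act1 : forall x, pts x -> act 1%g x = x;
  actM : forall g h x, pts x -> act (g * h)%g x = act g (act h x) }.

Lemma act_pts (G : finGroupType) (X : qpvar) (a : gaction G X) g x :
  pts x -> pts (a g x).
Proof. by apply: (proj1 (act_regular a g)). Qed.

Definition invariant (G : finGroupType) (X : qpvar) (a : gaction G X)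
    (S : pt X -> Prop) : Prop :=
  forall g x, pts x -> S x -> S (a g x).

Lemma invariantC (G : finGroupType) (X : qpvar) (a : gaction G X) S :
  invariant a S -> invariant a (fun x => ~ S x).
Proof.
move=> iS g x Px nS Sg; apply: nS; have := iS g^-1%g _ (act_pts a g Px) Sg.
by rewrite -(actM a) // mulVg act1.
Qed.

Lemma invariantT (G : finGroupType) (X : qpvar) (a : gaction G X) :
  invariant a (fun=> True).
Proof. by []. Qed.

Record gvar := GVar {
  gv_var :> qpvar;
  gv_grp : finGroupType;
  gv_act : gaction gv_grp gv_var }.

(* Isomorphism of varieties with pure actions; the groups need not be equal.  *)
Definition giso (Z Z' : gvar) : Prop :=
  exists (phi : gv_grp Z -> gv_grp Z') (psi : pt Z -> pt Z') (psi' : pt Z' -> pt Z),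
  [/\ bijective phi /\ {morph phi : g h / (g * h)%g},
      regular psi /\ regular psi',
      forall x, pts x -> psi' (psi x) = x,
      forall y, pts y -> psi (psi' y) = y
    & forall g x, pts x -> psi (gv_act Z g x) = gv_act Z' (phi g) (psi x)].

Section Restriction.
Variables (G : finGroupType) (X : qpvar) (a : gaction G X).
Variables (S : pt X -> Prop) (lcS : zlc S) (iS : invariant a S).

Lemma gact_sub_regular g : @regular (subvar lcS) (subvar lcS) (a g).
Proof.
split=> [x [Px Sx]|]; first by split; [exact: act_pts|exact: iS].
by case: (regular_from_sub lcS (act_regular a g)).
Qed.

Definition gact_sub : gaction G (subvar lcS) :=
  @GAction G (subvar lcS) a gact_sub_regular
    (fun x Px => act1 a Px.1) (fun g h x Px => actM a g h Px.1).
End Restriction.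

Definition gsub (Z : gvar) (S : pt Z -> Prop) (lcS : zlc S)
    (iS : invariant (gv_act Z) S) : gvar :=
  GVar (gact_sub lcS iS).

Section Product.
Variables (G H : finGroupType) (X Y : qpvar) (a : gaction G X) (b : gaction H Y).

Definition gact_prod_fun (gh : G * H) (z : pt (prodvar X Y)) : pt (prodvar X Y) :=
  (a gh.1 z.1, b gh.2 z.2).

Lemma gact_prod_regular gh : regular (gact_prod_fun gh).
Proof.
apply: regular_pair.
  exact: (regular_comp (regular_fst X Y) (act_regular a gh.1)).
exact: (regular_comp (regular_snd X Y) (act_regular b gh.2)).
Qed.

Lemma gact_prod1 z : pts z -> gact_prod_fun 1%g z = z.
Proof. by case: z => x y [/= Px Py]; rewrite /gact_prod_fun !act1. Qed.

Lemma gact_prodM g h z : pts z ->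
  gact_prod_fun (g * h)%g z = gact_prod_fun g (gact_prod_fun h z).
Proof. by case: z => x y [/= Px Py]; rewrite /gact_prod_fun !actM. Qed.

Definition gact_prod : gaction (G * H)%type (prodvar X Y) :=
  GAction gact_prod_regular gact_prod1 gact_prodM.
End Product.

Definition gprod (Z Z' : gvar) : gvar := GVar (gact_prod (gv_act Z) (gv_act Z')).

End Varieties.

Arguments pts {K q} _.
Arguments hc {K q} _.

(* The product s * t of permutations is the map i |-> t (s i), so that        *)
(* x |-> (i |-> x (s i)) is a left action of 'S_n, and the pair (f, s) acts   *)
(* on Z^n by x |-> (i |-> f i . x (s i)); the group law below is the          *)
(* corresponding one on the semidirect product of G^n and 'S_n.               *)
Record wreath (G : finGroupType) (n : nat) := Wreath {
  wr_fun : {ffun 'I_n -> G};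
  wr_perm : 'S_n }.

Section Wreath.
Variables (G : finGroupType) (n : nat).

Definition wreath_pair (w : wreath G n) := (wr_fun w, wr_perm w).
Definition pair_wreath (p : {ffun 'I_n -> G} * 'S_n) := Wreath p.1 p.2.
Lemma wreath_pairK : cancel wreath_pair pair_wreath.
Proof. by case. Qed.

HB.instance Definition _ := Finite.copy (wreath G n) (can_type wreath_pairK).

Definition wreath_one : wreath G n := Wreath [ffun=> 1%g] 1%g.
Definition wreath_mul (v w : wreath G n) : wreath G n :=
  Wreath [ffun i => (wr_fun v i * wr_fun w (wr_perm v i))%g] (wr_perm v * wr_perm w)%g.
Definition wreath_inv (w : wreath G n) : wreath G n :=
  Wreath [ffun i => (wr_fun w ((wr_perm w)^-1%g i))^-1%g] (wr_perm w)^-1%g.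

Lemma wreath_mulA : associative wreath_mul.
Proof.
move=> u v w; rewrite /wreath_mul /= mulgA; congr Wreath.
by apply/ffunP => i; rewrite !ffunE mulgA permM.
Qed.

Lemma wreath_mul1 : left_id wreath_one wreath_mul.
Proof.
move=> [f s]; rewrite /wreath_mul /= mul1g; congr Wreath.
by apply/ffunP => i; rewrite !ffunE mul1g perm1.
Qed.

Lemma wreath_mulV : left_inverse wreath_one wreath_inv wreath_mul.
Proof.
move=> [f s]; rewrite /wreath_mul /= mulVg; congr Wreath.
by apply/ffunP => i; rewrite !ffunE /= mulVg.
Qed.

HB.instance Definition _ :=
  Finite_isGroup.Build (wreath G n) wreath_mulA wreath_mul1 wreath_mulV.
End Wreath.

Section Powers.
Variables (K : closedFieldType) (Z : gvar K) (n : nat).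

Definition gpow_fun (w : wreath (gv_grp Z) n) (x : pt (powvar Z n)) : pt (powvar Z n) :=
  fun i => gv_act Z (wr_fun w i) (x (wr_perm w i)).

Lemma gpow_regular w : regular (gpow_fun w).
Proof.
apply: regular_tuple => i.
exact: (regular_comp (regular_proj Z (wr_perm w i)) (act_regular _ _)).
Qed.

Lemma gpow1 x : pts x -> gpow_fun 1%g x = x.
Proof.
by move=> Px; apply: funext => i; rewrite /gpow_fun /= ffunE perm1 act1.
Qed.

Lemma gpowM v w x : pts x -> gpow_fun (v * w)%g x = gpow_fun v (gpow_fun w x).
Proof.
by move=> Px; apply: funext => i; rewrite /gpow_fun /= ffunE permM actM.
Qed.

Definition gpow : gvar K := GVar (GAction gpow_regular gpow1 gpowM).
End Powers.

Section FiniteGroupsActions.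
Variable K : closedFieldType.
Local Notation qpvar := (qpvar K).
Local Notation gvar := (gvar K).

(* A variety decomposed into finitely many disjoint locally closed            *)
(* subvarieties, each of them with an action of its own finite group.         *)
Record fgvar := FGVar {
  fg_var :> qpvar;
  fg_idx : finType;
  fg_set : fg_idx -> pt fg_var -> Prop;
  fg_lc : forall i, zlc (fg_set i);
  fg_cover : forall x : pt fg_var, pts x -> exists! i, fg_set i x;
  fg_grp : fg_idx -> finGroupType;
  fg_act : forall i, gaction (fg_grp i) (subvar (fg_lc i)) }.

Definition fg_comp (X : fgvar) (i : fg_idx X) : gvar := GVar (fg_act i).

Lemma pure_cover (T : Type) (x : T) : True -> exists! i : unit, True.
Proof. by move=> _; exists tt; split=> // -[]. Qed.

Definition pure (Z : gvar) : fgvar :=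
  @FGVar Z unit (fun _ _ => True) (fun=> zlcT Z) (fun x _ => pure_cover x I)
    (fun=> gv_grp Z) (fun=> gact_sub (zlcT Z) (@invariantT _ _ _ (gv_act Z))).

Definition fg_invariant (X : fgvar) (S : pt X -> Prop) : Prop :=
  forall i : fg_idx X, invariant (fg_act i) S.

Lemma fg_invariantC (X : fgvar) (S : pt X -> Prop) :
  fg_invariant S -> fg_invariant (fun x => ~ S x).
Proof. by move=> iS i; apply: invariantC. Qed.

Section FGSub.
Variables (X : fgvar) (S : pt X -> Prop) (lcS : zlc S) (iS : fg_invariant S).

Lemma fgsub_cover (x : pt (subvar lcS)) : pts x -> exists! i, fg_set (f := X) i x.
Proof. by case=> Px _; apply: fg_cover. Qed.

Lemma fgsub_regular (i : fg_idx X) g :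
  @regular _ (subvar (zlc_sub lcS (fg_lc i))) (subvar (zlc_sub lcS (fg_lc i)))
    (fg_act i g).
Proof.
have r : @regular _ (subvar (zlc_sub lcS (fg_lc i))) (subvar (fg_lc i)) id.
  apply: regular_to_sub; last by move=> x [].
  by do 2 apply: regular_from_sub; apply: regular_id.
have ra := regular_comp r (act_regular (fg_act i) g).
apply: regular_to_sub; last by move=> x /(proj1 ra)[].
apply: regular_to_sub; first exact: (regular_of_sub ra).
by move=> x [[Px Sx] Tx]; apply: iS.
Qed.

Definition fgsub : fgvar :=
  @FGVar (subvar lcS) (fg_idx X) (@fg_set X) (fun i => zlc_sub lcS (fg_lc i))
    fgsub_cover (@fg_grp X)
    (fun i => @GAction _ _ (subvar (zlc_sub lcS (fg_lc i))) (fg_act i) (@fgsub_regular i)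
       (fun x Px => act1 (fg_act i) (conj Px.1.1 Px.2))
       (fun g h x Px => actM (fg_act i) g h (conj Px.1.1 Px.2))).
End FGSub.

Section FGProd.
Variables X Y : fgvar.

Definition fgprod_set (k : fg_idx X * fg_idx Y) (z : pt (prodvar X Y)) : Prop :=
  fg_set k.1 z.1 /\ fg_set k.2 z.2.

Lemma fgprod_lc k : zlc (fgprod_set k).
Proof. by apply: zlc_prod; apply: fg_lc. Qed.

Lemma fgprod_cover (z : pt (prodvar X Y)) : pts z -> exists! k, fgprod_set k z.
Proof.
case: z => x y [/= Px Py]; have [i [Xi ui]] := fg_cover Px.
have [j [Yj uj]] := fg_cover Py; exists (i, j); split=> // -[i' j'] [/= Xi' Yj'].
by rewrite (ui _ Xi') (uj _ Yj').
Qed.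

Lemma fgprod_regular k g :
  @regular _ (subvar (fgprod_lc k)) (subvar (fgprod_lc k))
    (gact_prod_fun (fg_act k.1) (fg_act k.2) g).
Proof.
pose W := subvar (fgprod_lc k).
have r1 : @regular _ W (subvar (fg_lc k.1)) fst.
  apply: regular_to_sub; last by move=> z [_ []].
  exact: (regular_from_sub _ (regular_fst X Y)).
have r2 : @regular _ W (subvar (fg_lc k.2)) snd.
  apply: regular_to_sub; last by move=> z [_ []].
  exact: (regular_from_sub _ (regular_snd X Y)).
have s1 := regular_comp r1 (act_regular (fg_act k.1) g.1).
have s2 := regular_comp r2 (act_regular (fg_act k.2) g.2).
apply: regular_to_sub.
  exact: (regular_pair (regular_of_sub s1) (regular_of_sub s2)).
by move=> z Pz; split; [case: (proj1 s1 z Pz)|case: (proj1 s2 z Pz)].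
Qed.

Lemma fgprod_act1 k (z : pt (subvar (fgprod_lc k))) : pts z ->
  gact_prod_fun (fg_act k.1) (fg_act k.2) 1%g z = z.
Proof.
case: z => x y [[/= Px Py] [/= Xx Yy]].
by rewrite /gact_prod_fun /= !act1.
Qed.

Lemma fgprod_actM k g h (z : pt (subvar (fgprod_lc k))) : pts z ->
  gact_prod_fun (fg_act k.1) (fg_act k.2) (g * h)%g z
  = gact_prod_fun (fg_act k.1) (fg_act k.2) g
      (gact_prod_fun (fg_act k.1) (fg_act k.2) h z).
Proof.
case: z => x y [[/= Px Py] [/= Xx Yy]].
by rewrite /gact_prod_fun /= !actM.
Qed.

Definition fgprod : fgvar :=
  @FGVar (prodvar X Y) _ fgprod_set fgprod_lc fgprod_cover
    (fun k => (fg_grp k.1 * fg_grp k.2)%type)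
    (fun k => GAction (@fgprod_regular k) (@fgprod_act1 k) (@fgprod_actM k)).
End FGProd.

(* The part number k is contained in the component number [part_idx k], whose *)
(* group acts on it.                                                          *)
Record fgpartition (X : fgvar) (N : finType) := FGPartition {
  part_idx : N -> fg_idx X;
  part_set : N -> pt X -> Prop;
  part_sub : forall k x, pts x -> part_set k x -> fg_set (part_idx k) x;
  part_lc : forall k, @zlc _ (fg_comp (part_idx k)) (part_set k);
  part_inv : forall k, invariant (fg_act (part_idx k)) (part_set k);
  part_cover : forall x : pt X, pts x -> exists! k, part_set k x }.

Definition piece (X : fgvar) (N : finType) (P : fgpartition X N) (k : N) : gvar :=
  @gsub _ (fg_comp (part_idx P k)) _ (part_lc P k) (@part_inv _ _ P k).

Definition fg_equiv (X Y : fgvar) : Prop :=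
  exists (N : finType) (P : fgpartition X N) (Q : fgpartition Y N),
    forall k, giso (piece P k) (piece Q k).

(* W is the induced variety of Z along the inclusion iota of its group in the *)
(* group H of W: pi exhibits W as the quotient of H * Z by the relation       *)
(* (h, x) ~ (h g^-1, g x), where H is seen as a finite discrete variety.      *)
Definition is_ind (Z W : gvar) (iota : gv_grp Z -> gv_grp W) : Prop :=
  [/\ injective iota, {morph iota : g h / (g * h)%g}
    & exists pi : gv_grp W * pt Z -> pt W,
      [/\ @regular _ (prodvar (finvar K (gv_grp W)) Z) W pi,
          forall w, pts w -> exists h x, pts x /\ pi (h, x) = w,
          forall h1 h2 x1 x2, pts x1 -> pts x2 ->
            (pi (h1, x1) = pi (h2, x2) <->
             exists g, h2 = (h1 * (iota g)^-1)%g /\ x2 = gv_act Z g x1),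
          forall h h1 x, pts x -> pi ((h * h1)%g, x) = gv_act W h (pi (h1, x))
        & forall (V : qpvar) (f : pt W -> pt V),
            @regular _ (prodvar (finvar K (gv_grp W)) Z) V (fun z => f (pi z)) ->
            regular f]].

(* Formal combinations of varieties with finite groups actions, and the       *)
(* congruence presenting the Grothendieck group: [K0_refl] to [K0_addN] make  *)
(* the quotient an abelian group, the last three are its defining relations.  *)
Inductive fexpr :=
  | FCls of fgvar | FZero | FOpp of fexpr | FAdd of fexpr & fexpr.

Inductive K0rel : fexpr -> fexpr -> Prop :=
  | K0_refl a : K0rel a a
  | K0_sym a b : K0rel a b -> K0rel b a
  | K0_trans b a c : K0rel a b -> K0rel b c -> K0rel a c
  | K0_opp a b : K0rel a b -> K0rel (FOpp a) (FOpp b)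
  | K0_add a a' b b' : K0rel a a' -> K0rel b b' -> K0rel (FAdd a b) (FAdd a' b')
  | K0_addA a b c : K0rel (FAdd a (FAdd b c)) (FAdd (FAdd a b) c)
  | K0_addC a b : K0rel (FAdd a b) (FAdd b a)
  | K0_add0 a : K0rel (FAdd FZero a) a
  | K0_addN a : K0rel (FAdd (FOpp a) a) FZero
  | K0_equiv X Y : fg_equiv X Y -> K0rel (FCls X) (FCls Y)
  | K0_closed (X : fgvar) (Y : pt X -> Prop) (cY : zclosed Y) (iY : fg_invariant Y) :
      K0rel (FCls X)
        (FAdd (FCls (fgsub (zclosed_lc cY) iY))
              (FCls (fgsub (zopen_lc (proj1 (zclosed_openC Y) cY)) (fg_invariantC iY))))
  | K0_ind Z W iota : @is_ind Z W iota -> K0rel (FCls (pure W)) (FCls (pure Z)).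

End FiniteGroupsActions.

(* The type of varieties with finite groups actions lies in a universe above  *)
(* the one of the carriers of MathComp structures, since it involves all      *)
(* finGroupTypes.  Hence its Grothendieck ring cannot be a comPzRingType, and *)
(* we use the following structures, without universe restriction.             *)
Record abGroup := AbGroup {
  ab_car :> Type;
  ab_zero : ab_car;
  ab_opp : ab_car -> ab_car;
  ab_add : ab_car -> ab_car -> ab_car;
  ab_addA : associative ab_add;
  ab_addC : commutative ab_add;
  ab_add0 : left_id ab_zero ab_add;
  ab_addN : left_inverse ab_zero ab_opp ab_add }.

Arguments ab_zero {a}.
Arguments ab_opp {a} _.
Arguments ab_add {a} _ _.

HB.instance Definition _ (A : abGroup) :=
  Monoid.isComLaw.Build A ab_zero ab_add (@ab_addA A) (@ab_addC A) (@ab_add0 A).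

Lemma ab_addI (A : abGroup) : right_injective (@ab_add A).
Proof.
by move=> a b c /(congr1 (ab_add (ab_opp a))); rewrite !ab_addA ab_addN !ab_add0.
Qed.

Lemma ab_addr0 (A : abGroup) (a : A) : ab_add a ab_zero = a.
Proof. by rewrite ab_addC ab_add0. Qed.

Lemma ab_oppD (A : abGroup) (a b : A) :
  ab_opp (ab_add a b) = ab_add (ab_opp a) (ab_opp b).
Proof.
apply: (@ab_addI A (ab_add a b)); rewrite ab_addC ab_addN.
rewrite -ab_addA [ab_add b _]ab_addC -ab_addA ab_addN ab_addr0.
by rewrite ab_addC ab_addN.
Qed.

Lemma ab_idem (A : abGroup) (a : A) : ab_add a a = a -> a = ab_zero.
Proof. by rewrite -[X in _ = X]ab_addr0 => /ab_addI. Qed.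

Lemma ab_oppE (A : abGroup) (a b : A) : ab_add a b = ab_zero -> a = ab_opp b.
Proof.
by move=> e; apply: (@ab_addI A b); rewrite ab_addC e ab_addC ab_addN.
Qed.

Record comRing := ComRing {
  cr_ab :> abGroup;
  cr_one : cr_ab;
  cr_mul : cr_ab -> cr_ab -> cr_ab;
  cr_mulA : associative cr_mul;
  cr_mulC : commutative cr_mul;
  cr_mul1 : left_id cr_one cr_mul;
  cr_mulD : left_distributive cr_mul ab_add }.

Arguments cr_one {c}.
Arguments cr_mul {c} _ _.

Section K0.
Variable K : closedFieldType.
Local Notation qpvar := (qpvar K).
Local Notation gvar := (gvar K).
Local Notation fgvar := (fgvar K).
Local Notation fexpr := (fexpr K).

Definition K0 : Type := {P : fexpr -> Prop | exists a, P = K0rel a}.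

Definition K0in (a : fexpr) : K0 := exist _ (K0rel a) (ex_intro _ a erefl).

Lemma K0inE a b : K0in a = K0in b <-> K0rel a b.
Proof.
split=> [/(congr1 sval) /= ->|ab]; first exact: K0_refl.
have e : K0rel a = K0rel b.
  apply: funext => c; apply/propext.
  by split=> h; [apply: K0_trans (K0_sym ab) h|apply: K0_trans ab h].
exact: eq_exist.
Qed.

Definition K0out (a : K0) : fexpr := sval (cid (svalP a)).

Lemma K0outK a : K0in (K0out a) = a.
Proof.
rewrite /K0in /K0out; case: (cid (svalP a)) => b /= e.
by case: a e => P h /= e; apply: eq_exist.
Qed.

Lemma K0out_rel a : K0rel (K0out (K0in a)) a.
Proof. by apply/K0inE; rewrite K0outK. Qed.

Definition K0zero : K0 := K0in (FZero K).
Definition K0opp (a : K0) : K0 := K0in (FOpp (K0out a)).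
Definition K0add (a b : K0) : K0 := K0in (FAdd (K0out a) (K0out b)).

Lemma K0addE a b : K0add (K0in a) (K0in b) = K0in (FAdd a b).
Proof. by apply/K0inE; apply: K0_add; apply: K0out_rel. Qed.

Lemma K0oppE a : K0opp (K0in a) = K0in (FOpp a).
Proof. by apply/K0inE; apply: K0_opp; apply: K0out_rel. Qed.

Lemma K0addA : associative K0add.
Proof.
move=> a b c; rewrite -(K0outK a) -(K0outK b) -(K0outK c) !K0addE.
by apply/K0inE; apply: K0_addA.
Qed.

Lemma K0addC : commutative K0add.
Proof. by move=> a b; apply/K0inE; apply: K0_addC. Qed.

Lemma K0add0 : left_id K0zero K0add.
Proof. by move=> a; rewrite -(K0outK a) K0addE; apply/K0inE; apply: K0_add0. Qed.

Lemma K0addN : left_inverse K0zero K0opp K0add.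
Proof. by move=> a; rewrite -(K0outK a) K0oppE K0addE; apply/K0inE; apply: K0_addN. Qed.

Definition K0group : abGroup := AbGroup K0addA K0addC K0add0 K0addN.

Definition K0class (X : fgvar) : K0group := K0in (FCls X).

(* The maps which extend to additive maps on K0. *)
Definition K0compat (A : abGroup) (f : fgvar -> A) : Prop :=
  [/\ forall X Y, fg_equiv X Y -> f X = f Y,
      forall (X : fgvar) (Y : pt X -> Prop) (cY : zclosed Y) (iY : fg_invariant Y),
        f X = ab_add (f (fgsub (zclosed_lc cY) iY))
          (f (fgsub (zopen_lc (proj1 (zclosed_openC Y) cY)) (fg_invariantC iY)))
    & forall Z W iota, @is_ind K Z W iota -> f (pure W) = f (pure Z)].

Fixpoint fexpr_lift (A : abGroup) (f : fgvar -> A) (a : fexpr) : A :=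
  match a with
  | FCls X => f X
  | FZero => ab_zero
  | FOpp a => ab_opp (fexpr_lift f a)
  | FAdd a b => ab_add (fexpr_lift f a) (fexpr_lift f b)
  end.

Definition K0lift (A : abGroup) (f : fgvar -> A) (a : K0) : A :=
  fexpr_lift f (K0out a).

Section Lift.
Variables (A : abGroup) (f : fgvar -> A).
Hypothesis cf : K0compat f.

Lemma fexpr_lift_rel a b : K0rel a b -> fexpr_lift f a = fexpr_lift f b.
Proof.
case: cf => f1 f2 f3; elim=> {a b} /=.
- by [].
- by move=> a b _ ->.
- by move=> b a c _ -> _ ->.
- by move=> a b _ ->.
- by move=> a a' b b' _ -> _ ->.
- by move=> a b c; rewrite ab_addA.
- by move=> a b; rewrite ab_addC.
- by move=> a; rewrite ab_add0.
- by move=> a; rewrite ab_addN.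
- exact: f1.
- exact: f2.
- exact: f3.
Qed.

Lemma K0liftE a : K0lift f (K0in a) = fexpr_lift f a.
Proof. by apply: fexpr_lift_rel; apply: K0out_rel. Qed.

Lemma K0lift_class X : K0lift f (K0class X) = f X.
Proof. exact: K0liftE. Qed.

Lemma K0lift_add a b : K0lift f (K0add a b) = ab_add (K0lift f a) (K0lift f b).
Proof. by rewrite -(K0outK a) -(K0outK b) K0addE !K0liftE. Qed.
End Lift.

Lemma K0_additive_ext (A : abGroup) (f g : K0 -> A) :
  (forall a b, f (K0add a b) = ab_add (f a) (f b)) ->
  (forall a b, g (K0add a b) = ab_add (g a) (g b)) ->
  (forall X, f (K0class X) = g (K0class X)) -> f =1 g.
Proof.
move=> fD gD fg a; rewrite -(K0outK a); elim: (K0out a) => {a} [X||a IH|a IHa b IHb].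
- exact: fg.
- have z h : (forall a b, h (K0add a b) = ab_add (h a) (h b)) -> h K0zero = ab_zero :> A.
    by move=> hD; apply: ab_idem; rewrite -hD K0add0.
  by rewrite (z f fD) (z g gD).
- have z h : (forall a b, h (K0add a b) = ab_add (h a) (h b)) ->
      h (K0in (FOpp a)) = ab_opp (h (K0in a)) :> A.
    move=> hD; apply: ab_oppE; rewrite -hD -K0oppE K0addN.
    by apply: ab_idem; rewrite -hD K0add0.
  by rewrite (z f fD) (z g gD) IH.
- by rewrite -K0addE fD gD IHa IHb.
Qed.

Lemma giso_refl (Z : gvar) : giso Z Z.
Proof.
exists id, id, id; split=> //; first by split=> //; exists id.
by split; apply: regular_id.
Qed.

Lemma giso_trans (Z2 Z1 Z3 : gvar) : giso Z1 Z2 -> giso Z2 Z3 -> giso Z1 Z3.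
Proof.
move=> [p [f [f' [[bp mp] [rf rf'] fK f'K ef]]]].
move=> [q [g [g' [[bq mq] [rg rg'] gK g'K eg]]]].
exists (q \o p), (fun x => g (f x)), (fun x => f' (g' x)); split.
- by split; [exact: bij_comp|move=> x y /=; rewrite mp mq].
- by split; [exact: (regular_comp rf rg)|exact: (regular_comp rg' rf')].
- by move=> x Px; rewrite gK ?fK //; apply: (proj1 rf).
- by move=> x Px; rewrite f'K ?g'K //; apply: (proj1 rg').
- by move=> a x Px /=; rewrite ef // eg //; apply: (proj1 rf).
Qed.

Lemma giso_sym (Z Z' : gvar) : giso Z Z' -> giso Z' Z.
Proof.
move=> [p [f [f' [[[q pK qK] mp] [rf rf'] fK f'K ef]]]].
exists q, f', f; split=> //.
  split; first by exists p.
  by move=> g h; apply: (can_inj pK); rewrite mp !qK.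
move=> g y Py; have Px := proj1 rf' y Py.
rewrite -{1}[g]qK -{1}(f'K y Py) -ef // fK //.
exact: act_pts.
Qed.

Lemma giso_gprod (Z1 Z2 W1 W2 : gvar) :
  giso Z1 Z2 -> giso W1 W2 -> giso (gprod Z1 W1) (gprod Z2 W2).
Proof.
move=> [p [f [f' [[bp mp] [rf rf'] fK f'K ef]]]].
move=> [q [g [g' [[bq mq] [rg rg'] gK g'K eg]]]].
have [p' pK p'K] := bp; have [q' qK q'K] := bq.
pose F (z : pt (prodvar Z1 W1)) : pt (prodvar Z2 W2) := (f z.1, g z.2).
pose F' (z : pt (prodvar Z2 W2)) : pt (prodvar Z1 W1) := (f' z.1, g' z.2).
exists (fun gh => (p gh.1, q gh.2)), F, F'; split.
- split; last by move=> x y /=; rewrite mp mq.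
  by exists (fun gh => (p' gh.1, q' gh.2)) => -[x y] /=; rewrite ?pK ?p'K ?qK ?q'K.
- split; apply: regular_pair.
  + exact: (regular_comp (regular_fst _ _) rf).
  + exact: (regular_comp (regular_snd _ _) rg).
  + exact: (regular_comp (regular_fst _ _) rf').
  + exact: (regular_comp (regular_snd _ _) rg').
- by move=> [x y] [/= Px Py]; rewrite /F /F' /= fK ?gK.
- by move=> [x y] [/= Px Py]; rewrite /F /F' /= f'K ?g'K.
- by move=> [g1 g2] [x y] [/= Px Py]; rewrite /F /gact_prod_fun /= ef ?eg.
Qed.

Lemma regular_same (T : Type) (P Q : T -> Prop) N (h : T -> 'rV[K]_N)
    (hP : is_qp P h) (hQ : is_qp Q h) :
  (forall x, P x -> Q x) -> @regular K (QPVar hP) (QPVar hQ) (fun x => x).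
Proof.
move=> PQ; split=> // x Px; exists (fun=> True); split=> //; first exact: zopenT.
exists 1%N, (fun i => 'X_i); split=> [j|y Py _]; first exact: homogX.
exists 1; first exact: oner_neq0.
by apply/rowP => j; rewrite !mxE evX mul1r.
Qed.

Local Ltac giso_same :=
  exists (fun g => g), (fun x => x), (fun x => x); split;
    [by split=> //; exists id|split|try done|try done|try done].

Definition part_full (X : fgvar) : fgpartition X (fg_idx X) :=
  @FGPartition K X (fg_idx X) id (@fg_set K X) (fun k x _ h => h)
   (fun k => zlc_sub (fg_lc k) (fg_lc k))
   (fun k g x Px _ => (act_pts (fg_act k) g Px).2)
   (@fg_cover K X).

Lemma piece_full (X : fgvar) i : giso (piece (part_full X) i) (fg_comp i).
Proof.
giso_same.
  by apply: regular_from_sub; apply: regular_id.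
by apply: regular_to_sub; [exact: regular_id|move=> x []].
Qed.

Definition part_reindex (X : fgvar) (N : finType) (s : N -> fg_idx X)
    (s' : fg_idx X -> N) (sK : cancel s s') (s'K : cancel s' s) : fgpartition X N.
Proof.
refine (@FGPartition K X N s (fun k => fg_set (s k)) (fun k x _ h => h)
   (fun k => zlc_sub (fg_lc (s k)) (fg_lc (s k)))
   (fun k g x Px _ => (act_pts (fg_act (s k)) g Px).2) _).
move=> x Px; have [i [Xi ui]] := fg_cover Px; exists (s' i).
by split=> [|j Xj]; [rewrite s'K|apply: (can_inj sK); rewrite s'K; apply: ui].
Defined.

(* Two varieties with finite groups actions whose components are isomorphic,  *)
(* up to renumbering, are equivalent.                                         *)
Lemma equiv_comp (X Y : fgvar) (s : fg_idx X -> fg_idx Y) (s' : fg_idx Y -> fg_idx X) :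
  cancel s s' -> cancel s' s -> (forall i, giso (fg_comp i) (fg_comp (s i))) -> fg_equiv X Y.
Proof.
move=> sK s'K h; exists (fg_idx X), (part_full X), (part_reindex sK s'K) => i.
apply: giso_trans (piece_full i) _; apply: giso_trans (h i) _; apply: giso_sym.
giso_same.
  by apply: regular_from_sub; apply: regular_id.
by apply: regular_to_sub; [exact: regular_id|move=> x []].
Qed.

Lemma comp_pure (Z : gvar) i : giso (fg_comp (X := pure Z) i) Z.
Proof.
case: i; case: Z => X G a; giso_same.
  by apply: regular_from_sub; apply: regular_id.
by apply: regular_to_sub; first exact: regular_id.
Qed.

Lemma regular_subprod (X Y : qpvar) (S : pt X -> Prop) (T : pt Y -> Prop)
    (lS : zlc S) (lT : zlc T)
    (lST : @zlc _ (prodvar X Y) (fun z => S z.1 /\ T z.2)) :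
  @regular K (subvar lST) (prodvar (subvar lS) (subvar lT)) (fun z => z)
  /\ @regular K (prodvar (subvar lS) (subvar lT)) (subvar lST) (fun z => z).
Proof.
split.
  apply: (@regular_ext K (subvar lST) (prodvar (subvar lS) (subvar lT)) _
    (fun z : pt (prodvar X Y) => (z.1, z.2))); first by case.
  apply: regular_pair; apply: regular_to_sub.
  + by apply: regular_from_sub; apply: regular_fst.
  + by move=> z [_ []].
  + by apply: regular_from_sub; apply: regular_snd.
  + by move=> z [_ []].
apply: regular_to_sub; last by move=> z [[_ h1] [_ h2]].
have h1 := regular_of_sub (@regular_fst K (subvar lS) (subvar lT)).
have h2 := regular_of_sub (@regular_snd K (subvar lS) (subvar lT)).
by apply: regular_ext (regular_pair h1 h2) => -[].
Qed.

Lemma comp_fgprod (X Y : fgvar) (k : fg_idx X * fg_idx Y) :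
  giso (fg_comp (X := fgprod X Y) k) (gprod (fg_comp k.1) (fg_comp k.2)).
Proof.
have [h1 h2] := regular_subprod (fg_lc k.1) (fg_lc k.2) (fgprod_lc k).
by giso_same.
Qed.

Lemma fgprod_equivC (X Y : fgvar) : fg_equiv (fgprod X Y) (fgprod Y X).
Proof.
apply: (@equiv_comp (fgprod X Y) (fgprod Y X) (fun k => (k.2, k.1))
  (fun k => (k.2, k.1))) => [[]|[]|[i j]] //.
apply: giso_trans (comp_fgprod _) _; apply: giso_trans _ (giso_sym (comp_fgprod _)).
pose F (Z W : gvar) (z : pt (prodvar Z W)) : pt (prodvar W Z) := (z.2, z.1).
have rF Z W : regular (@F Z W).
  exact: (regular_pair (regular_snd _ _) (regular_fst _ _)).
exists (fun g => (g.2, g.1)), (@F (fg_comp i) (fg_comp j)), (@F (fg_comp j) (fg_comp i)).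
split=> //.
- by split=> //; exists (fun g => (g.2, g.1)); case.
- by split; apply: rF.
- by case.
- by case.
Qed.

Lemma fgprod_equivA (X Y Z : fgvar) :
  fg_equiv (fgprod X (fgprod Y Z)) (fgprod (fgprod X Y) Z).
Proof.
apply: (@equiv_comp (fgprod X (fgprod Y Z)) (fgprod (fgprod X Y) Z)
  (fun k => ((k.1, k.2.1), k.2.2)) (fun k => (k.1.1, (k.1.2, k.2))))
  => [[i [j k]]|[[i j] k]|[i [j k]]] //.
apply: giso_trans (comp_fgprod _) _; apply: giso_trans _ (giso_sym (comp_fgprod _)).
apply: giso_trans (giso_gprod (giso_refl _) (comp_fgprod _)) _.
apply: giso_trans _ (giso_gprod (giso_sym (comp_fgprod _)) (giso_refl _)) => /=.
move: (fg_comp i) (fg_comp j) (fg_comp k) => A B C.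
pose F (z : pt (prodvar A (prodvar B C))) : pt (prodvar (prodvar A B) C) :=
  ((z.1, z.2.1), z.2.2).
pose F' (z : pt (prodvar (prodvar A B) C)) : pt (prodvar A (prodvar B C)) :=
  (z.1.1, (z.1.2, z.2)).
have rF : regular F.
  apply: regular_pair; first apply: regular_pair.
  - exact: regular_fst.
  - exact: (regular_comp (regular_snd _ _) (regular_fst _ _)).
  - exact: (regular_comp (regular_snd _ _) (regular_snd _ _)).
have rF' : regular F'.
  apply: regular_pair; last apply: regular_pair.
  - exact: (regular_comp (regular_fst _ _) (regular_fst _ _)).
  - exact: (regular_comp (regular_fst _ _) (regular_snd _ _)).
  - exact: regular_snd.
exists (fun g => ((g.1, g.2.1), g.2.2)), F, F'; split=> //.
- split=> //; exists (fun g => (g.1.1, (g.1.2, g.2))); first by case=> ? [].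
  by case=> -[].
- by case=> ? [].
- by case=> -[].
Qed.

Lemma gprod_one (Z : gvar) (P : qpvar) (a : gaction 'I_1 P) (p : pt P) :
  pts p -> (forall q, pts q -> q = p) -> giso (gprod (GVar a) Z) Z.
Proof.
move=> Pp Pu; pose F (z : pt (prodvar P Z)) : pt Z := z.2.
have rc : regular (fun _ : pt Z => p).
  split=> // x _; exists (fun=> True); split=> //; first exact: zopenT.
  exists 0%N, (fun i => (hc p 0 i)%:MP); split=> [i|y _ _].
    by rewrite -[_%:MP]mulr1 mul_mpolyC; apply: rpredZ; apply: dhomog1.
  exists 1; first exact: oner_neq0.
  by apply/rowP => i; rewrite !mxE mul1r /ev mevalC.
exists snd, F, (fun x => (p, x)); split=> //.
- split=> //; exists (fun g => (1%g, g)) => //; move=> [g h] /=.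
  by rewrite [g]ord1 [1%g]ord1.
- split; first exact: regular_snd.
  exact: (regular_pair rc (regular_id _)).
- by move=> [q x] [/= /Pu -> _].
Qed.


Section PartProd.
Variables (X W : fgvar) (N : finType) (P : fgpartition X N).

Definition partprod_set (k : N * fg_idx W) (z : pt (prodvar X W)) : Prop :=
  part_set P k.1 z.1 /\ fg_set k.2 z.2.

Lemma partprod_sub (k : N * fg_idx W) (z : pt (fgprod X W)) :
  pts z -> partprod_set k z ->
  fg_set (f := fgprod X W) (part_idx P k.1, k.2) z.
Proof. by case: z => x y [/= Px Py] [/= h ?]; split=> //; apply: part_sub h. Qed.

Lemma partprod_lc (k : N * fg_idx W) :
  @zlc K (fg_comp (X := fgprod X W) (part_idx P k.1, k.2)) (partprod_set k).
Proof.
have r1 : @regular K (fg_comp (X := fgprod X W) (part_idx P k.1, k.2))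
    (fg_comp (part_idx P k.1)) fst.
  apply: regular_to_sub; last by move=> z [_ []].
  by apply: regular_from_sub; apply: regular_fst.
apply: zlcI; first exact: (zlc_pre r1 (part_lc P k.1)).
by apply: zlc_sub; apply: (zlc_pre (regular_snd X W)); apply: fg_lc.
Qed.

Lemma partprod_inv (k : N * fg_idx W) :
  invariant (fg_act (f := fgprod X W) (part_idx P k.1, k.2)) (partprod_set k).
Proof.
move=> g [x y] [/= [Px Py] [/= Xx Yy]] [/= Sx _]; split=> /=.
  exact: part_inv.
by have [] := act_pts (fg_act k.2) g.2 (conj Py Yy : @pts K (subvar (fg_lc k.2)) y).
Qed.

Lemma partprod_cover (z : pt (fgprod X W)) : pts z -> exists! k, partprod_set k z.
Proof.
case: z => x y [/= Px Py]; have [i [Xi ui]] := part_cover P Px.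
have [j [Yj uj]] := fg_cover Py; exists (i, j); split=> // -[i' j'] [/= Xi' Yj'].
by rewrite (ui _ Xi') (uj _ Yj').
Qed.

Definition partprod : fgpartition (fgprod X W) (N * fg_idx W)%type :=
  FGPartition partprod_sub partprod_lc partprod_inv partprod_cover.

Lemma piece_partprod k : giso (piece partprod k) (gprod (piece P k.1) (fg_comp k.2)).
Proof.
giso_same; apply: regular_same.
- by move=> [x y] /= [[[? ?] [? ?]] [? ?]].
- by move=> [x y] /= [[[? ?] ?] [? ?]].
Qed.
End PartProd.

Lemma fgprod_equiv (X Y W : fgvar) :
  fg_equiv X Y -> fg_equiv (fgprod X W) (fgprod Y W).
Proof.
move=> [N [P [Q h]]]; exists (N * fg_idx W)%type, (partprod W P), (partprod W Q) => k.
apply: (giso_trans (piece_partprod P k)).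
apply: (giso_trans _ (giso_sym (piece_partprod Q k))).
by apply: giso_gprod => //; apply: giso_refl.
Qed.

Lemma K0class_equiv (X Y : fgvar) : fg_equiv X Y -> K0class X = K0class Y.
Proof. by move=> h; apply/K0inE; apply: K0_equiv. Qed.

Lemma K0class_closed (X : fgvar) (Y : pt X -> Prop)
    (cY : zclosed Y) (iY : fg_invariant Y) :
  K0class X = ab_add (K0class (fgsub (zclosed_lc cY) iY))
    (K0class (fgsub (zopen_lc (proj1 (zclosed_openC Y) cY)) (fg_invariantC iY))).
Proof. by rewrite /K0class /= K0addE; apply/K0inE; apply: K0_closed. Qed.

Lemma fgprod_sub (X W : fgvar) (S : pt X -> Prop) (lS : zlc S) (iS : fg_invariant S)
    (lS' : @zlc K (fgprod X W) (fun z => S z.1))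
    (iS' : @fg_invariant K (fgprod X W) (fun z => S z.1)) :
  fg_equiv (fgsub lS' iS') (fgprod (fgsub lS iS) W).
Proof.
apply: (@equiv_comp (fgsub lS' iS') (fgprod (fgsub lS iS) W) (fun k => k) (fun k => k))
  => // k.
giso_same; apply: regular_same.
- by move=> [x y] /= [[[? ?] ?] [? ?]].
- by move=> [x y] /= [[[? ?] ?] [? ?]].
Qed.

Lemma zopen_finprod (T : finType) (X : qpvar) (U : T -> pt X -> Prop) :
  (forall t, zopen (U t)) ->
  @zopen K (prodvar (finvar K T) X) (fun z => U z.1 z.2).
Proof.
move=> oU; apply/zopenP => -[t x] Px Ux.
have o1 := regular_cont (regular_fst (finvar K T) X) (zopen_fin K (fun s => s = t)).
have o2 := regular_cont (regular_snd (finvar K T) X) (oU t).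
have /zopenP/(_ _ Px (conj erefl Ux)) [r [hr nr rU]] := zopenI o1 o2.
by exists r; split=> // -[s y] Py /(rU _ Py) [/= ->].
Qed.

Lemma zclosed_finprod (T : finType) (X : qpvar) (S : T -> pt X -> Prop) :
  (forall t, zclosed (S t)) ->
  @zclosed K (prodvar (finvar K T) X) (fun z => S z.1 z.2).
Proof.
move=> cS; apply/zclosed_openC; apply: (zopen_finprod (U := fun t x => ~ S t x)) => t.
by apply/(proj1 (zclosed_openC _)).
Qed.

Lemma zlc_finprod (T : finType) (X : qpvar) (S : T -> pt X -> Prop) :
  (forall t, zlc (S t)) ->
  @zlc K (prodvar (finvar K T) X) (fun z => S z.1 z.2).
Proof.
move=> lS; have [F /choice [U h]] := choice lS.
exists (fun z => F z.1 z.2), (fun z => U z.1 z.2); split.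
- by apply: zclosed_finprod => t; case: (h t).
- by apply: zopen_finprod => t; case: (h t).
- by move=> [t x] [_ Px]; case: (h t) => _ _; apply.
Qed.

Section DisjointUnion.
Variable X : fgvar.
Local Notation I := (fg_idx X).

Definition djvar : qpvar := subvar (zlc_finprod (fg_lc (f := X))).

Lemma dj_clopen (A : I -> Prop) :
  @zclosed K djvar (fun z => A z.1) /\ @zopen K djvar (fun z => A z.1).
Proof.
have h B : @zopen K djvar (fun z => B z.1).
  apply: zopen_sub; exact: (regular_cont (regular_fst _ _) (zopen_fin K B)).
by split=> //; apply/zclosed_openC; apply: (h (fun t => ~ A t)).
Qed.

Definition dj_set (i : I) (z : pt djvar) : Prop := z.1 = i.

Lemma dj_lc i : zlc (dj_set i).
Proof. by apply: zopen_lc; have [] := dj_clopen (fun t => t = i). Qed.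

Lemma dj_cover (z : pt djvar) : pts z -> exists! i, dj_set i z.
Proof. by exists z.1; split. Qed.

Definition dj_fun i (g : fg_grp (f := X) i) (z : pt djvar) : pt djvar :=
  (z.1, fg_act i g z.2).

Lemma dj_to i : @regular K (subvar (dj_lc i)) (fg_comp (X := X) i) snd.
Proof.
apply: regular_to_sub; last by move=> [j x] /= [[_ Sx] <-].
by do 2 apply: regular_from_sub; apply: regular_snd.
Qed.

Lemma dj_from i : @regular K (fg_comp (X := X) i) (subvar (dj_lc i)) (fun x => (i, x)).
Proof.
apply: regular_to_sub; last by [].
apply: regular_to_sub; last by move=> x [].
apply: regular_from_sub; apply: regular_pair; [exact: regular_finconst|exact: regular_id].
Qed.

Lemma dj_regular i g :
  @regular K (subvar (dj_lc i)) (subvar (dj_lc i)) (dj_fun (i := i) g).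
Proof.
apply: regular_ext (regular_comp (regular_comp (dj_to i)
  (act_regular (fg_act i) g)) (dj_from i)).
by move=> [j x] [_ e]; congr (_, _); apply: e.
Qed.

Lemma dj_act1 i (z : pt (subvar (dj_lc i))) : pts z -> dj_fun (i := i) 1%g z = z.
Proof. by case: z => j x [[[_ Px] Sx] /= ji]; rewrite /dj_fun /= act1 // -ji. Qed.

Lemma dj_actM i g h (z : pt (subvar (dj_lc i))) : pts z ->
  dj_fun (i := i) (g * h)%g z = dj_fun g (dj_fun h z).
Proof. by case: z => j x [[[_ Px] Sx] /= ji]; rewrite /dj_fun /= actM // -ji. Qed.

Definition disjoint_union : fgvar :=
  @FGVar K djvar I dj_set dj_lc dj_cover (@fg_grp K X)
    (fun i => GAction (@dj_regular i) (@dj_act1 i) (@dj_actM i)).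

Lemma comp_dj i : giso (fg_comp (X := disjoint_union) i) (fg_comp (X := X) i).
Proof.
exists id, snd, (fun x => (i, x)); split=> //.
- by split=> //; exists id.
- by split; [exact: dj_to|exact: dj_from].
- by move=> [j x] [_ e]; congr (_, _); apply/esym/e.
Qed.

Lemma dj_equiv : fg_equiv X disjoint_union.
Proof.
apply: (@equiv_comp X disjoint_union (fun i => i) (fun i => i)) => // i.
exact/giso_sym/comp_dj.
Qed.

Lemma dj_inv (A : I -> Prop) :
  @fg_invariant K disjoint_union (fun z => A z.1).
Proof. by move=> i g [j x] _ /=. Qed.

Definition dj_part (A : I -> Prop) : fgvar :=
  @fgsub K disjoint_union (fun z => A z.1) (zclosed_lc (dj_clopen A).1) (@dj_inv A).

Lemma dj_part_equiv (A B : I -> Prop) (lc : zlc (fun z : pt (dj_part A) => B z.1))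
    (inv : @fg_invariant K (dj_part A) (fun z => B z.1)) (C : I -> Prop) :
  (forall i, C i <-> A i /\ B i) -> K0class (fgsub lc inv) = K0class (dj_part C).
Proof.
move=> h; apply: K0class_equiv.
apply: (@equiv_comp (fgsub lc inv) (dj_part C) (fun i => i) (fun i => i)) => // i.
giso_same; apply: regular_same => -[j x] /=.
- by move=> [[[? ?] ?] ?]; split=> //; split=> //; apply/h.
- by move=> [[? /h[? ?]] ?].
Qed.

Lemma dj_partI (A B : I -> Prop) :
  K0class (dj_part A) = ab_add (K0class (dj_part (fun i => A i /\ B i)))
                               (K0class (dj_part (fun i => A i /\ ~ B i))).
Proof.
have cB : @zclosed K (dj_part A) (fun z => B z.1).
  by apply: zclosed_sub; have [] := dj_clopen B.
have iB : @fg_invariant K (dj_part A) (fun z => B z.1) by move=> i g [j x] _ /=.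
rewrite (K0class_closed cB iB); congr ab_add.
  exact: dj_part_equiv.
exact: (dj_part_equiv (B := fun i => ~ B i)).
Qed.

Lemma dj_part_ext (A B : I -> Prop) :
  (forall i, A i <-> B i) -> K0class (dj_part A) = K0class (dj_part B).
Proof. by move=> AB; have -> : A = B by apply: funext => i; apply/propext. Qed.

Lemma dj_part0 : K0class (dj_part (fun=> False)) = ab_zero.
Proof.
apply: ab_idem; rewrite {3}(dj_partI _ (fun=> True)).
by congr ab_add; apply: dj_part_ext => i; tauto.
Qed.

Lemma dj_part1 i : K0class (dj_part (fun j => j = i)) = K0class (pure (fg_comp (X := X) i)).
Proof.
apply: K0class_equiv; set D := dj_part _.
have cT (x : pt D) : pts x -> exists! k : unit, dj_set i x.
  by case=> _ /= e; exists tt; split=> // -[].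
have sT (k : unit) (x : pt D) : pts x -> dj_set i x -> fg_set (f := D) i x by [].
have lT (k : unit) : @zlc K (fg_comp (X := D) i) (dj_set i).
  exact: (zlc_sub _ (fg_lc (f := D) i)).
have iT (k : unit) : invariant (fg_act (f := D) i) (dj_set i) by move=> g [j x] _.
exists unit, (FGPartition sT lT iT cT), (part_full _) => k.
apply: giso_trans _ (giso_sym (piece_full _)).
apply: giso_trans _ (giso_sym (comp_pure _)).
apply: giso_trans _ (comp_dj i).
giso_same; apply: regular_same => -[j x] /=.
- by move=> [[[? ?] ?] ?].
- by move=> [? ?].
Qed.

Lemma K0class_comp :
  K0class X = \big[ab_add/ab_zero]_(i : I) K0class (pure (fg_comp (X := X) i)).
Proof.
have key (r : seq I) : uniq r -> K0class (dj_part (fun i => i \in r))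
    = \big[ab_add/ab_zero]_(i <- r) K0class (pure (fg_comp (X := X) i)).
  elim: r => [_|i r IH /andP[ir ur]].
    by rewrite big_nil -dj_part0; apply: dj_part_ext.
  rewrite big_cons -IH // -dj_part1 (dj_partI _ (fun j => j = i)).
  congr ab_add; apply: dj_part_ext => j; rewrite inE.
    by split=> [[]|-> ] //; rewrite eqxx.
  split=> [[/orP[/eqP|]] //|jr]; rewrite jr orbT; split=> // e.
  by move: ir; rewrite -e jr.
rewrite -(key _ (index_enum_uniq _)) (K0class_equiv dj_equiv); apply: K0class_equiv.
apply: (@equiv_comp disjoint_union (dj_part _) (fun i => i) (fun i => i)) => // i.
giso_same; apply: regular_same => -[j x] /=.
- by move=> [? ?]; rewrite mem_index_enum.
- by move=> [[? ?] ?].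
Qed.
End DisjointUnion.

Lemma regular_finmap (T T' : finType) (u : T -> T') :
  @regular K (finvar K T) (finvar K T') u.
Proof.
apply: regular_local => t _; exists (fun s => s = t), (fun=> u t); split=> //.
- exact: zopen_fin.
- exact: regular_finconst.
- by move=> s _ ->.
Qed.

Section Ind.
Variables (Z W : gvar) (iota : gv_grp Z -> gv_grp W).
Hypothesis iota_inj : injective iota.
Hypothesis iotaM : {morph iota : g h / (g * h)%g}.

Lemma iota1 : iota 1%g = 1%g.
Proof. by apply: (@mulgI _ (iota 1%g)); rewrite -iotaM !mulg1. Qed.

Definition cosetb (h h' : gv_grp W) := [exists g, h' == (h * (iota g)^-1)%g].

Lemma cosetb_refl h : cosetb h h.
Proof. by apply/existsP; exists 1%g; rewrite iota1 invg1 mulg1. Qed.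

Definition crep h := odflt h [pick h' | cosetb h h'].

Lemma crepP h : exists g, crep h = (h * (iota g)^-1)%g.
Proof.
rewrite /crep; case: pickP => [h' /existsP[g /eqP ->]|/(_ h)]; first by exists g.
by rewrite cosetb_refl.
Qed.

Lemma crepM h g : crep (h * (iota g)^-1)%g = crep h.
Proof.
rewrite /crep; have e : cosetb (h * (iota g)^-1)%g =1 cosetb h.
  move=> h'; apply/existsP/existsP => -[k /eqP ->].
    by exists (k * g)%g; rewrite iotaM invMg mulgA.
  by exists (k * g^-1)%g; rewrite -mulgA -invMg -iotaM mulgKV.
by rewrite (eq_pick e); case: pickP => // /(_ h); rewrite cosetb_refl.
Qed.

Definition cgam h : gv_grp Z := sval (cid (crepP h)).

Lemma cgamE h : crep h = (h * (iota (cgam h))^-1)%g.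
Proof. by rewrite /cgam; case: cid. Qed.

Lemma cgamM h g : (cgam (h * (iota g)^-1) * g)%g = cgam h.
Proof.
apply: iota_inj; apply: invg_inj; apply: (@mulgI _ h).
by rewrite iotaM invMg mulgA -cgamE crepM cgamE.
Qed.

Definition cnorm (z : gv_grp W * pt Z) : gv_grp W * pt Z :=
  (crep z.1, gv_act Z (cgam z.1) z.2).

Lemma cnorm_regular :
  @regular K (prodvar (finvar K (gv_grp W)) Z) (prodvar (finvar K (gv_grp W)) Z) cnorm.
Proof.
apply: (@regular_finprod K (gv_grp W) Z (prodvar (finvar K (gv_grp W)) Z)
  (fun h x => (crep h, gv_act Z (cgam h) x))) => h.
by apply: regular_pair; [exact: regular_finconst|exact: act_regular].
Qed.

Lemma cnorm_eq h g x : pts x ->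
  cnorm ((h * (iota g)^-1)%g, gv_act Z g x) = cnorm (h, x).
Proof. by move=> Px; rewrite /cnorm /= crepM -(cgamM h g) actM. Qed.
End Ind.

Lemma is_ind_gprod (Z W V : gvar) (iota : gv_grp Z -> gv_grp W) :
  is_ind iota ->
  @is_ind K (gprod Z V) (gprod W V) (fun g => (iota g.1, g.2)).
Proof.
move=> [iinj iM [pi [rpi sur fib equ univ]]].
have rpih h : regular (fun x : pt Z => pi (h, x)).
  exact: (regular_comp (regular_pair (@regular_finconst K _ Z h) (regular_id Z)) rpi).
have Ppi h x : pts x -> pts (pi (h, x)).
  by move=> Px; apply: (proj1 rpi).
split.
- by move=> [g k] [g' k'] /= [/iinj -> ->].
- by move=> [g k] [g' k'] /=; rewrite iM.
pose pi' (z : (gv_grp W * gv_grp V) * (pt Z * pt V)) : pt (prodvar W V) :=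
  (pi (z.1.1, z.2.1), gv_act V z.1.2 z.2.2).
exists pi'; split.
- apply: (@regular_finprod K _ (prodvar Z V) (prodvar W V)
    (fun hk x => (pi (hk.1, x.1), gv_act V hk.2 x.2))) => -[h k] /=.
  apply: regular_pair; first exact: (regular_comp (regular_fst _ _) (rpih h)).
  exact: (regular_comp (regular_snd _ _) (act_regular (gv_act V) k)).
- move=> [w v] [/= /sur[h [x [Px <-]]] Pv].
  by exists (h, 1%g), (x, v); split=> //; rewrite /pi' /= act1.
- move=> [h1 k1] [h2 k2] [x1 v1] [x2 v2] [/= Px1 Pv1] [/= Px2 Pv2].
  split=> [[/(fib _ _ _ _ Px1 Px2) [g [-> ->]] ek]|].
    exists (g, (k2^-1 * k1)%g); rewrite /gact_prod_fun /=; split; congr (_, _).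
      by change (k2 = k1 * (k2^-1 * k1)^-1)%g; rewrite invMg invgK mulgA mulgV mul1g.
    by rewrite actM // ek -actM // mulVg act1.
  move=> [[g k] [[-> ->] [-> ->]]] /=; rewrite /pi' /=; congr (_, _).
    by apply/fib => //; [exact: act_pts|exists g].
  by rewrite -actM // mulgKV.
- move=> [h k] [h1 k1] [x v] [/= Px Pv]; rewrite /pi' /gact_prod_fun /=.
  by rewrite equ // actM.
move=> U f rf.
have [[w0 Pw0]|nW] := pselect (exists w : pt W, pts w); last first.
  by split=> -[w v] [/= Pw _]; case: nW; exists w.
have [h0 [x0 [Px0 _]]] := sur w0 Pw0.
have /choice [s hs] (w : pt W) : exists hx : gv_grp W * pt Z,
    pts w -> pts hx.2 /\ pi hx = w.
  have [/sur [h [x [Px e]]]|nw] := pselect (pts w); first by exists (h, x).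
  by exists (h0, x0).
pose sg w := cnorm iM (s w).
have rsg : @regular K W (prodvar (finvar K (gv_grp W)) Z) sg.
  apply: univ; apply: regular_ext (cnorm_regular iM) => -[h x] [_ Px].
  have [Psx e] := hs _ (Ppi h x Px); rewrite /sg.
  case: (s (pi (h, x))) Psx e => h' x' /= Px' e.
  have [g [-> ->]] := (fib h' h x' x Px' Px).1 e.
  by rewrite cnorm_eq.
have sgK w : pts w -> pi (sg w) = w.
  move=> Pw; have [Ps e] := hs w Pw; rewrite -[RHS]e /sg.
  case: (s w) Ps {e} => h x /= Px; apply/esym/fib => //; first exact: act_pts.
  by exists (cgam iM h); rewrite -cgamE.
pose s' (z : pt (prodvar W V)) := (((sg z.1).1, 1%g : gv_grp V), ((sg z.1).2, z.2)).
have rs' : @regular K (prodvar W V)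
    (prodvar (finvar K (gv_grp W * gv_grp V)%type) (prodvar Z V)) s'.
  have r1 := regular_comp (regular_fst W V) rsg.
  have r2 := regular_comp r1 (regular_fst _ _).
  apply: regular_pair.
    exact: (regular_comp r2 (@regular_finmap _ _ (fun h => (h, 1%g : gv_grp V)))).
  apply: regular_pair; last exact: regular_snd.
  exact: (regular_comp r1 (regular_snd _ _)).
apply: regular_ext (regular_comp rs' rf) => -[w v] [/= Pw Pv].
congr f; change ((w, v) = (pi ((sg w).1, (sg w).2), gv_act V 1%g v)).
by rewrite act1 // -surjective_pairing sgK.
Qed.

Lemma K0class_ind (Z W : gvar) (iota : gv_grp Z -> gv_grp W) :
  is_ind iota -> K0class (pure W) = K0class (pure Z).
Proof. by move=> h; apply/K0inE; apply: K0_ind h. Qed.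

Lemma pure_giso (Z Z' : gvar) : giso Z Z' -> K0class (pure Z) = K0class (pure Z').
Proof.
move=> h; apply: K0class_equiv.
apply: (@equiv_comp (pure Z) (pure Z') (fun i => i) (fun i => i)) => // i.
by apply: giso_trans (comp_pure _) _; apply: giso_trans h (giso_sym (comp_pure _)).
Qed.

Lemma K0class_pureM (Z : gvar) (W : fgvar) :
  K0class (fgprod (pure Z) W)
  = \big[ab_add/ab_zero]_(j : fg_idx W) K0class (pure (gprod Z (fg_comp j))).
Proof.
rewrite K0class_comp.
rewrite (reindex (fun j => (tt, j))) /=; last first.
  by exists snd => // -[[] j].
apply: eq_bigr => j _; apply: pure_giso.
apply: giso_trans (comp_fgprod _) _; apply: giso_gprod; last exact: giso_refl.
exact: comp_pure.
Qed.

Lemma fgprod_compat (W : fgvar) : K0compat (fun X => K0class (fgprod X W)).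
Proof.
split=> [X Y|X Y cY iY|Z V iota ind].
- by move/fgprod_equiv => h; apply: K0class_equiv.
- have cY' : @zclosed K (fgprod X W) (fun z => Y z.1).
    exact: (zclosed_pre (regular_fst X W) cY).
  have iY' : @fg_invariant K (fgprod X W) (fun z => Y z.1).
    by move=> k g [x y] [[Px Py] [Sx Sy]] /= Yx; apply: (iY k.1).
  rewrite (K0class_closed cY' iY').
  by congr ab_add; apply: K0class_equiv;
    [exact: fgprod_sub|exact: (fgprod_sub (S := fun x => ~ Y x))].
rewrite !K0class_pureM; apply: eq_bigr => j _.
exact: K0class_ind (is_ind_gprod (fg_comp j) ind).
Qed.

Definition fun_group (T : Type) (A : abGroup) : abGroup :=
  @AbGroup (T -> A) (fun=> ab_zero) (fun f x => ab_opp (f x))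
    (fun f g x => ab_add (f x) (g x))
    (fun f g h => funext (fun x => ab_addA (f x) (g x) (h x)))
    (fun f g => funext (fun x => ab_addC (f x) (g x)))
    (fun f => funext (fun x => ab_add0 (f x)))
    (fun f => funext (fun x => ab_addN (f x))).

(* The bilinear extension of [X] * [Y] = [X * Y]. *)
Definition K0mul : K0 -> K0 -> K0 :=
  K0lift (A := fun_group K0 K0group)
    (fun X => K0lift (A := K0group) (fun Y => K0class (fgprod X Y))).

Lemma fgprod_compatr (X : fgvar) : K0compat (fun Y => K0class (fgprod X Y)).
Proof.
have -> : (fun Y => K0class (fgprod X Y)) = (fun Y => K0class (fgprod Y X)).
  by apply: funext => Y; apply: K0class_equiv; apply: fgprod_equivC.
exact: fgprod_compat.
Qed.

Lemma K0mul_compat : K0compat (A := fun_group K0 K0group)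
  (fun X => K0lift (A := K0group) (fun Y => K0class (fgprod X Y))).
Proof.
split=> [X Y XY|X Y cY iY|Z W iota ind]; apply: funext => b.
- apply: (K0_additive_ext (A := K0group)) b => [a b|a b|V].
  + exact: (K0lift_add (fgprod_compatr X)).
  + exact: (K0lift_add (fgprod_compatr Y)).
  rewrite (K0lift_class (fgprod_compatr X)) (K0lift_class (fgprod_compatr Y)).
  by have [h _ _] := fgprod_compat V; apply: h.
- set A := fgsub _ _; set B := fgsub _ _.
  apply: (K0_additive_ext (A := K0group)
    (g := fun b => K0add (K0lift (A := K0group) (fun Y => K0class (fgprod A Y)) b)
                         (K0lift (A := K0group) (fun Y => K0class (fgprod B Y)) b)))
    b => [a b|a b|V].
  + exact: (K0lift_add (fgprod_compatr X)).
  + rewrite (K0lift_add (fgprod_compatr A)) (K0lift_add (fgprod_compatr B)) /=.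
    by rewrite -!K0addA; congr K0add; rewrite !K0addA; congr K0add; rewrite K0addC.
  rewrite (K0lift_class (fgprod_compatr X)) (K0lift_class (fgprod_compatr A)).
  rewrite (K0lift_class (fgprod_compatr B)).
  by have [_ h _] := fgprod_compat V; apply: h.
apply: (K0_additive_ext (A := K0group)) b => [a b|a b|V].
- exact: (K0lift_add (fgprod_compatr (pure W))).
- exact: (K0lift_add (fgprod_compatr (pure Z))).
rewrite (K0lift_class (fgprod_compatr (pure W))) (K0lift_class (fgprod_compatr (pure Z))).
by have [_ _ h] := fgprod_compat V; apply: h ind.
Qed.

Lemma K0mulDl a b c : K0mul (K0add a b) c = K0add (K0mul a c) (K0mul b c).
Proof. by rewrite /K0mul (K0lift_add K0mul_compat). Qed.

Lemma K0mul_classl X b :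
  K0mul (K0class X) b = K0lift (A := K0group) (fun Y => K0class (fgprod X Y)) b.
Proof. by rewrite /K0mul (K0lift_class K0mul_compat). Qed.

Lemma K0mul_class X Y : K0mul (K0class X) (K0class Y) = K0class (fgprod X Y).
Proof. by rewrite K0mul_classl (K0lift_class (fgprod_compatr X)). Qed.

Lemma K0mulDr a b c : K0mul a (K0add b c) = K0add (K0mul a b) (K0mul a c).
Proof.
apply: (K0_additive_ext (A := K0group) (f := fun a => K0mul a (K0add b c))
  (g := fun a => K0add (K0mul a b) (K0mul a c))) a => [x y|x y|X].
- exact: K0mulDl.
- rewrite !K0mulDl /= -!K0addA; congr K0add.
  by rewrite !K0addA; congr K0add; rewrite K0addC.
by rewrite !K0mul_classl (K0lift_add (fgprod_compatr X)).
Qed.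

Lemma K0mulC : commutative K0mul.
Proof.
move=> a b; apply: (K0_additive_ext (A := K0group) (f := fun a => K0mul a b)
  (g := fun a => K0mul b a)) a => [x y|x y|X]; [exact: K0mulDl|exact: K0mulDr|].
apply: (K0_additive_ext (A := K0group) (f := fun b => K0mul (K0class X) b)
  (g := fun b => K0mul b (K0class X))) b => [x y|x y|Y]; [exact: K0mulDr|exact: K0mulDl|].
by rewrite !K0mul_class; apply: K0class_equiv; apply: fgprod_equivC.
Qed.

Lemma K0mulA : associative K0mul.
Proof.
move=> a b c.
apply: (K0_additive_ext (A := K0group) (f := fun a => K0mul a (K0mul b c))
  (g := fun a => K0mul (K0mul a b) c)) a => [x y|x y|X].
- exact: K0mulDl.
- by rewrite !K0mulDl.
apply: (K0_additive_ext (A := K0group) (f := fun b => K0mul (K0class X) (K0mul b c))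
  (g := fun b => K0mul (K0mul (K0class X) b) c)) b => [x y|x y|Y].
- by rewrite K0mulDl K0mulDr.
- by rewrite K0mulDr K0mulDl.
apply: (K0_additive_ext (A := K0group)
  (f := fun c => K0mul (K0class X) (K0mul (K0class Y) c))
  (g := fun c => K0mul (K0mul (K0class X) (K0class Y)) c)) c => [x y|x y|Z].
- by rewrite !K0mulDr.
- by rewrite !K0mulDr.
by rewrite !K0mul_class; apply: K0class_equiv; apply: fgprod_equivA.
Qed.

(* The one-point variety with the action of the trivial group 'I_1 = Z/1Z. *)
Lemma gpoint_actM (g h : 'I_1) (x : pt (finvar K unit)) : pts x -> x = x.
Proof. by []. Qed.

Definition gpoint : gvar :=
  GVar (@GAction K 'I_1 (finvar K unit) (fun _ x => x)
    (fun=> regular_id (finvar K unit)) (fun _ _ => erefl) gpoint_actM).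

Definition K0one : K0 := K0class (pure gpoint).

Lemma K0mul1 : left_id K0one K0mul.
Proof.
move=> a; apply: (K0_additive_ext (A := K0group) (f := fun a => K0mul K0one a)
  (g := fun a => a)) a => [x y|//|X]; first exact: K0mulDr.
rewrite K0mul_class K0class_pureM [RHS]K0class_comp; apply: eq_bigr => j _.
apply: pure_giso; refine (@gprod_one (fg_comp j) (finvar K unit) _ tt I _).
by case.
Qed.

Lemma K0mulD : left_distributive K0mul K0add.
Proof. by move=> a b c; apply: K0mulDl. Qed.

Definition K0ring : comRing :=
  @ComRing K0group K0one K0mul K0mulA K0mulC K0mul1 K0mulD.

Lemma K0mul_pure (Z1 Z2 : gvar) :
  K0mul (K0class (pure Z1)) (K0class (pure Z2)) = K0class (pure (gprod Z1 Z2)).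
Proof.
rewrite K0mul_class; apply: K0class_equiv.
apply: (@equiv_comp (fgprod (pure Z1) (pure Z2)) (pure (gprod Z1 Z2))
  (fun=> tt) (fun=> (tt, tt))) => [[[] []]|[]|k] //.
apply: giso_trans (comp_fgprod _) _; apply: giso_trans _ (giso_sym (comp_pure _)).
by apply: giso_gprod; apply: comp_pure.
Qed.

Definition kapranov_zeta (Z : gvar) (n : nat) : K0ring :=
  if n is 0 then cr_one else K0class (pure (gpow Z n)).

End K0.

(* Formal power series, as sequences of coefficients. *)
Definition pseries (R : comRing) : Type := nat -> R.

Definition psmul (R : comRing) (a b : pseries R) : pseries R :=
  fun n => \big[ab_add/ab_zero]_(i < n.+1) cr_mul (a i) (b (n - i)%N).

Record lambda_structure (R : comRing) (lam : R -> pseries R) : Prop := {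
  lambda_coef0 : forall a, lam a 0%N = cr_one;
  lambda_coef1 : forall a, lam a 1%N = a;
  lambda_add : forall a b, lam (ab_add a b) = psmul (lam a) (lam b) }.

(* Main.v *)
From HB Require Import structures.
From mathcomp Require Import all_boot all_order all_algebra all_fingroup.
From mathcomp Require Import boolp mpoly reals complex.
Require Import Defs.

Set Implicit Arguments.
Unset Strict Implicit.
Unset Printing Implicit Defensive.

(** The point is that the series of the powers of a variety with a pure action
is a generalized Euler characteristic with values in the multiplicative group
of power series with constant term 1 ([useries_group]), and that such an
invariant extends uniquely to the Grothendieck group.

[sum_comp_compat] is the general principle: an invariant of varieties with pure
actions which is unchanged by isomorphisms and by induction, and additive with
respect to a closed invariant subvariety and its complement, induces an additive
map on the Grothendieck group.  The nontrivial part is that such an invariant is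
additive for every partition into locally closed invariant pieces
([measure_cover]); this holds because each piece is the intersection of a closed
invariant set and an open invariant one, so that pieces can be split off one at
a time.

For the Kapranov zeta function, additivity means that for Y closed invariant in
Z, with complement U, the class of Z^n is the sum over m + p = n of the products
[Y^m][U^p].  Indeed Z^n is the disjoint union of the invariant locally closed
strata of the points with exactly p coordinates in U, and such a stratum is
induced from Y^m x U^p along the inclusion of the wreath products
G_m x G_p in G_n ([stratum_class], [uzeta_closed]).  Compatibility with
induction holds since the inclusion of G_n in H_n makes the power of an induced
variety the induced variety of the power ([uzeta_ind]).

Both facts on induction need a way to recognize induced varieties without
handling quotients.  The variety W with an action of H is induced from Z along
an inclusion of G in H exactly when W contains Z as an open subvariety whose
translates cover W and such that only the elements of G can send a point of Z
back into Z.  Such an embedding is called a [slice]; up to the case of an empty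
W, the correspondence is [slice_is_ind] and [is_ind_slice].  Slices are visibly
stable under Cartesian powers ([slice_gpow]), and in a stratum of Z^n the points
whose last p coordinates lie in U form one ([stratum_slice]).

Uniqueness holds because the classes of pure actions generate the group
([K0_additive_ext_pure]). *)

(** * Power series with constant term 1 *)

Section UnitalSeries.
Variable R : comRing.
Local Notation "a +' b" := (@ab_add (cr_ab R) a b) (at level 50, left associativity).
Local Notation "a *' b" := (@cr_mul R a b) (at level 40, left associativity).
Local Notation "\Sum_ ( i < n | P ) F" := (\big[@ab_add (cr_ab R)/ab_zero]_(i < n | P) F)
  (at level 41, i at level 50).
Local Notation "\Sum_ ( i < n ) F" := (\big[@ab_add (cr_ab R)/ab_zero]_(i < n) F)
  (at level 41, i at level 50).

Lemma cr_mul0 (a : R) : ab_zero *' a = ab_zero.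
Proof. by apply: ab_idem; rewrite -cr_mulD ab_add0. Qed.

Lemma cr_mulr0 (a : R) : a *' ab_zero = ab_zero.
Proof. by rewrite cr_mulC cr_mul0. Qed.

Lemma cr_mulr1 (a : R) : a *' cr_one = a.
Proof. by rewrite cr_mulC cr_mul1. Qed.

Lemma cr_suml (I : finType) (P : pred I) (F : I -> R) (b : R) :
  (\big[@ab_add (cr_ab R)/ab_zero]_(i | P i) F i) *' b
  = \big[@ab_add (cr_ab R)/ab_zero]_(i | P i) (F i *' b).
Proof.
apply: (big_morph (fun a => a *' b)) => [x y|]; first exact: cr_mulD.
exact: cr_mul0.
Qed.

Lemma cr_sumr (I : finType) (P : pred I) (F : I -> R) (b : R) :
  b *' (\big[@ab_add (cr_ab R)/ab_zero]_(i | P i) F i)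
  = \big[@ab_add (cr_ab R)/ab_zero]_(i | P i) (b *' F i).
Proof. by rewrite cr_mulC cr_suml; apply: eq_bigr => i _; rewrite cr_mulC. Qed.

Lemma psmulE (a b : pseries R) n :
  psmul a b n = \Sum_(i < n.+1) \Sum_(j < n.+1 | i + j == n) (a i *' b j).
Proof.
apply: eq_bigr => i _.
have lt_ni : n - i < n.+1 by rewrite ltnS leq_subr.
rewrite (big_pred1 (Ordinal lt_ni)) // => j.
apply/eqP/eqP => [e|->]; last by rewrite /= subnKC // leq_ord.
by apply: val_inj; rewrite /= -[LHS](addKn i) e.
Qed.

Lemma psmulC (a b : pseries R) : psmul a b = psmul b a.
Proof.
apply: funext => n; rewrite !psmulE (exchange_big_dep predT) //=; apply: eq_bigr => i _.
by apply: eq_big => [j|j _]; [rewrite addnC|rewrite cr_mulC].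
Qed.

Lemma psmulA (a b c : pseries R) : psmul a (psmul b c) = psmul (psmul a b) c.
Proof.
have narrow n (i : 'I_n.+1) (F : nat -> R) :
    \Sum_(k < (n - i).+1) F k = \Sum_(k < n.+1 | k <= n - i) F k.
  by rewrite (big_ord_narrow_leq (leq_subr _ _)).
have psmul_rev (d e : pseries R) m : psmul d e m = \Sum_(k < m.+1) (d (m - k)%N *' e k).
  rewrite psmulC; apply: eq_bigr => i _; exact: cr_mulC.
apply: funext => n.
pose t (i k : nat) := a i *' (b (n - i - k)%N *' c k).
transitivity (\Sum_(i < n.+1) \Sum_(k < n.+1 | k <= n - i) t i k).
  apply: eq_bigr => i _; rewrite psmul_rev cr_sumr.
  exact: (narrow n i (fun k => t i k)).
rewrite (exchange_big_dep predT) //= psmul_rev; apply: eq_bigr => k _.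
transitivity (\Sum_(i < n.+1 | i <= n - k) t i k).
  apply: eq_bigl => i; have := leq_ord i; have := leq_ord k.
  by move=> kn i_n; rewrite !leq_subRL // addnC.
rewrite -(narrow n k (fun i => t i k)) cr_suml.
by apply: eq_bigr => i _; rewrite /t cr_mulA subnAC.
Qed.

Definition psone : pseries R := fun n => if n is 0 then cr_one else ab_zero.

Lemma psmul1 (a : pseries R) : psmul psone a = a.
Proof.
apply: funext => n; rewrite /psmul big_ord_recl /= cr_mul1 subn0.
rewrite big1 ?ab_addr0 // => i _; exact: cr_mul0.
Qed.

Lemma psmul_coef0 (a b : pseries R) : psmul a b 0 = a 0 *' b 0.
Proof. by rewrite /psmul big_ord1. Qed.

Lemma psmul_coef1 (a b : pseries R) : psmul a b 1 = a 0 *' b 1 +' a 1 *' b 0.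
Proof. by rewrite /psmul big_ord_recl big_ord1. Qed.

(** Course-of-values recursion for the inverse of a, whose coefficients of index
at most n are those of [psinv_upto a n]. *)
Fixpoint psinv_upto (a : pseries R) (n : nat) : pseries R :=
  if n is n'.+1 then
    fun m => if m == n'.+1
      then ab_opp (\Sum_(i < n'.+1) (a i.+1 *' psinv_upto a n' (n' - i)%N))
      else psinv_upto a n' m
  else fun=> cr_one.

Definition psinv (a : pseries R) : pseries R := fun n => psinv_upto a n n.

Lemma psinv_uptoE a n m : m <= n -> psinv_upto a n m = psinv a m.
Proof.
elim: n m => [|n IH] m; first by rewrite leqn0 => /eqP ->.
rewrite leq_eqVlt => /orP[/eqP -> //|lt_mn] /=.
by rewrite (ltn_eqF lt_mn) IH.
Qed.

Lemma psmulV (a : pseries R) : a 0 = cr_one -> psmul (psinv a) a = psone.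
Proof.
move=> a0; rewrite psmulC; apply: funext => -[|n].
  by rewrite psmul_coef0 a0 cr_mul1.
rewrite /psmul big_ord_recl subn0 a0 cr_mul1.
rewrite {1}/psinv /= eqxx -[RHS](@ab_addN _ (\Sum_(i < n.+1) (a i.+1 *' psinv a (n - i)%N))).
congr (ab_opp _ +' _).
by apply: eq_bigr => i _; rewrite psinv_uptoE // leq_subr.
Qed.

Definition useries : Type := {a : pseries R | a 0 = cr_one}.

Lemma useries_ext (a b : useries) : sval a =1 sval b -> a = b.
Proof.
case: a b => [a a0] [b b0] /= ab; apply: eq_exist.
exact: funext.
Qed.

Definition us_one : useries := exist _ psone erefl.

Lemma us_mul_subproof (a b : useries) : psmul (sval a) (sval b) 0 = cr_one.
Proof. by rewrite psmul_coef0 (svalP a) (svalP b) cr_mul1. Qed.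
Definition us_mul (a b : useries) : useries := exist _ _ (us_mul_subproof a b).

Definition us_inv (a : useries) : useries := exist _ (psinv (sval a)) erefl.

Lemma us_mulA : associative us_mul.
Proof. by move=> a b c; apply: useries_ext => n /=; rewrite psmulA. Qed.
Lemma us_mulC : commutative us_mul.
Proof. by move=> a b; apply: useries_ext => n /=; rewrite psmulC. Qed.
Lemma us_mul1 : left_id us_one us_mul.
Proof. by move=> a; apply: useries_ext => n /=; rewrite psmul1. Qed.
Lemma us_mulV : left_inverse us_one us_inv us_mul.
Proof. by move=> a; apply: useries_ext => n /=; rewrite psmulV // (svalP a). Qed.

Definition useries_group : abGroup := AbGroup us_mulA us_mulC us_mul1 us_mulV.

Lemma us_coef1_add (a b : useries_group) :
  sval (ab_add a b) 1 = sval a 1 +' sval b 1.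
Proof. by rewrite /= psmul_coef1 (svalP a) (svalP b) cr_mul1 cr_mulr1 ab_addC. Qed.
End UnitalSeries.

(** * Zariski topology and regular maps *)

Section Topology.
Variable K : closedFieldType.
Implicit Types X Y : qpvar K.

Lemma zopen_local X (U : pt X -> Prop) :
  (forall x, pts x -> U x ->
     exists V, [/\ zopen V, V x & forall y, pts y -> V y -> U y]) -> zopen U.
Proof.
move=> h; apply/zopenP => x Px Ux; have [V [/zopenP oV Vx VU]] := h x Px Ux.
have [r [hr nr rV]] := oV x Px Vx.
by exists r; split=> // y Py /(rV y Py); apply: VU.
Qed.

Lemma zopen_ex X (I : Type) (U : I -> pt X -> Prop) :
  (forall i, zopen (U i)) -> zopen (fun x => exists i, U i x).
Proof.
move=> oU; apply: zopen_local => x Px [i Ux].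
by exists (U i); split=> // y _ Uy; exists i.
Qed.

Lemma zopen_all X (I : finType) (U : I -> pt X -> Prop) :
  (forall i, zopen (U i)) -> zopen (fun x => forall i, U i x).
Proof.
move=> oU; have h (s : seq I) : zopen (fun x => forall i, i \in s -> U i x).
  elim: s => [|i s IH]; first exact: zopen_ext (zopenT X).
  apply: zopen_ext (zopenI (oU i) IH) => x _; split=> [[Ui Us] j|Us].
    by rewrite inE => /orP[/eqP -> //|]; apply: Us.
  by split=> [|j js]; apply: Us; rewrite inE ?eqxx ?js ?orbT.
apply: zopen_ext (h (enum I)) => x _; split=> Ux i //.
by apply: Ux; rewrite mem_enum.
Qed.

Lemma zclosed_all X (I : Type) (F : I -> pt X -> Prop) :
  (forall i, zclosed (F i)) -> zclosed (fun x => forall i, F i x).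
Proof.
move=> cF; apply/zclosed_openC.
apply: zopen_ext (zopen_ex (fun i => proj1 (zclosed_openC _) (cF i))) => x _.
exact: existsNP.
Qed.

(** Being open is transitive, which is not immediate here: both topologies are
given by homogeneous polynomials, which have to be multiplied. *)
Lemma zopen_of_subopen X (U V : pt X -> Prop) (oU : zopen U) :
  @zopen K (subvar (zopen_lc oU)) V -> zopen (fun x => U x /\ V x).
Proof.
move=> /zopenP oV; apply/zopenP => x Px [Ux Vx].
have [r [hr nr rV]] := oV x (conj Px Ux) Vx.
move/zopenP: (oU) => /(_ x Px Ux) [s [hs ns sU]].
exists (s * r)%R; split; first exact: homogM.
  by rewrite evM GRing.mulf_neq0.
move=> y Py; rewrite evM GRing.mulf_eq0 negb_or => /andP[/(sU y Py) Uy ry].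
by split=> //; apply: rV.
Qed.

Lemma regular_cover X Y (f : pt X -> pt Y) :
  (forall x, pts x -> exists U (oU : zopen U),
     U x /\ @regular K (subvar (zopen_lc oU)) Y f) ->
  regular f.
Proof.
move=> h; split=> x Px; have [U [oU [Ux [fP hf]]]] := h x Px.
  exact: (fP x (conj Px Ux)).
have [V [oV Vx [d [F [hF eF]]]]] := hf x (conj Px Ux).
exists (fun y => U y /\ V y); split=> //; first exact: zopen_of_subopen.
by exists d, F; split=> // y Py [Uy Vy]; apply: eF.
Qed.
End Topology.

(** * Additive invariants of pure actions *)

(** For two varieties on the same set of points, with the same action; what
remains to be checked is the regularity of the identity both ways. *)
Ltac giso_same :=
  exists (fun g => g), (fun x => x), (fun x => x); split;
    [by split=> //; exists id|split|try done|try done|try done].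

Section Additive.
Variable K : closedFieldType.
Implicit Types Z W : gvar K.

Lemma gsub_ext Z (S T : pt Z -> Prop) (lS : zlc S) (iS : invariant (gv_act Z) S)
    (lT : zlc T) (iT : invariant (gv_act Z) T) :
  (forall x, pts x -> (S x <-> T x)) -> giso (gsub lS iS) (gsub lT iT).
Proof.
move=> ST; giso_same; apply: regular_same => x [Px Sx]; split=> //.
  by apply/(ST x Px).
by apply/(ST x Px).
Qed.

Lemma gsub_gsub Z (S T R : pt Z -> Prop) (lS : zlc S) (iS : invariant (gv_act Z) S)
    (lT : @zlc K (gsub lS iS) T) (iT : invariant (gv_act (gsub lS iS)) T)
    (lR : zlc R) (iR : invariant (gv_act Z) R) :
  (forall x, pts x -> (R x <-> S x /\ T x)) -> giso (gsub lT iT) (gsub lR iR).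
Proof.
move=> RST; giso_same; apply: regular_same.
  by move=> x [[Px Sx] Tx]; split=> //; apply/(RST x Px).
by move=> x [Px /(RST x Px) [Sx Tx]].
Qed.

Definition lcinv Z (S : pt Z -> Prop) : Prop := zlc S /\ invariant (gv_act Z) S.

Lemma invariantI Z (S T : pt Z -> Prop) :
  invariant (gv_act Z) S -> invariant (gv_act Z) T ->
  invariant (gv_act Z) (fun x => S x /\ T x).
Proof. by move=> iS iT g x Px [Sx Tx]; split; [apply: iS|apply: iT]. Qed.

Lemma lcinvI Z (S T : pt Z -> Prop) : lcinv S -> lcinv T -> lcinv (fun x => S x /\ T x).
Proof. by move=> [lS iS] [lT iT]; split; [apply: zlcI|apply: invariantI]. Qed.

(** If S = F /\ U is invariant, so are the intersection of the translates of F
and the union of the translates of U, and their intersection is still S: a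
point of it with a translate in U has this translate in F as well, hence in S. *)
Lemma lcinv_open_closed Z (S : pt Z -> Prop) : lcinv S ->
  exists F U : pt Z -> Prop,
    [/\ zclosed F /\ invariant (gv_act Z) F, zopen U /\ invariant (gv_act Z) U
      & forall x, pts x -> (S x <-> F x /\ U x)].
Proof.
move=> [[F [U [cF oU SFU]]] iS].
pose F' x := forall g, F (gv_act Z g x); pose U' x := exists g, U (gv_act Z g x).
exists F', U'; split.
- split=> [|g x Px Fx h]; last by rewrite -actM.
  by apply: zclosed_all => g; apply: zclosed_pre cF; apply: act_regular.
- split=> [|g x Px [h Ux]]; last by exists (h * g^-1)%g; rewrite -actM // mulgKV.
  by apply: zopen_ex => g; apply: regular_cont oU; apply: act_regular.
move=> x Px; split=> [Sx|[Fx [g Ux]]].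
  split=> [g|]; last by exists 1%g; rewrite act1 //; case/(SFU x Px): Sx.
  by case/(SFU _ (act_pts _ g Px)): (iS g x Px Sx).
have /iS : S (gv_act Z g x) by apply/(SFU _ (act_pts _ g Px)).
move=> /(_ g^-1%g (act_pts _ g Px)).
by rewrite -actM // mulVg act1.
Qed.

Variables (A : abGroup) (mu : gvar K -> A).
Hypothesis mu_giso : forall Z W, giso Z W -> mu Z = mu W.
Hypothesis mu_closed : forall Z (Y : pt Z -> Prop)
    (cY : zclosed Y) (iY : invariant (gv_act Z) Y),
  mu Z = ab_add (mu (gsub (zclosed_lc cY) iY))
    (mu (gsub (zopen_lc (proj1 (zclosed_openC Y) cY)) (invariantC iY))).

(** The value of mu on an invariant locally closed subset.  It is total, with
junk value 0, so that no proofs of these two properties appear in sums. *)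
Definition measure Z (S : pt Z -> Prop) : A :=
  if pselect (lcinv S) is left h then mu (gsub (proj1 h) (proj2 h)) else ab_zero.

Lemma measureE Z (S : pt Z -> Prop) (lS : zlc S) (iS : invariant (gv_act Z) S) :
  measure S = mu (gsub lS iS).
Proof.
rewrite /measure; case: pselect => [h|[]//].
by apply: mu_giso; apply: gsub_ext.
Qed.

Lemma measure_ext Z (S T : pt Z -> Prop) :
  lcinv S -> (forall x, pts x -> (S x <-> T x)) -> measure S = measure T.
Proof.
move=> [lS iS] ST; have lT : zlc T by apply: zlc_ext lS.
have iT : invariant (gv_act Z) T.
  move=> g x Px /(ST x Px) Sx; apply/(ST _ (act_pts _ g Px)); exact: iS.
by rewrite (measureE lS iS) (measureE lT iT); apply/mu_giso/gsub_ext.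
Qed.

Lemma measureT Z : measure (fun _ : pt Z => True) = mu Z.
Proof.
rewrite (measureE (zlcT Z) (@invariantT _ _ _ (gv_act Z))); apply: mu_giso.
giso_same; first by apply: regular_from_sub; apply: regular_id.
by apply: regular_to_sub => //; apply: regular_id.
Qed.

Lemma measure_closed Z (S Y : pt Z -> Prop) :
  lcinv S -> zclosed Y -> invariant (gv_act Z) Y ->
  measure S = ab_add (measure (fun x => S x /\ Y x)) (measure (fun x => S x /\ ~ Y x)).
Proof.
move=> [lS iS] cY iY.
have [lY iY'] := lcinvI (conj lS iS : lcinv S) (conj (zclosed_lc cY) iY : lcinv Y).
have [lN iN] := lcinvI (conj lS iS : lcinv S)
  (conj (zopen_lc (proj1 (zclosed_openC Y) cY)) (invariantC iY) : lcinv (fun x => ~ Y x)).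
rewrite (measureE lS iS) (measureE lY iY') (measureE lN iN).
have cY' : @zclosed K (gsub lS iS) Y by apply: zclosed_sub.
have iY2 : invariant (gv_act (gsub lS iS)) Y by move=> g x [Px _]; apply: iY.
rewrite (mu_closed cY' iY2).
by congr ab_add; apply: mu_giso; apply: gsub_gsub.
Qed.

Lemma measure_open Z (S U : pt Z -> Prop) :
  lcinv S -> zopen U -> invariant (gv_act Z) U ->
  measure S = ab_add (measure (fun x => S x /\ U x)) (measure (fun x => S x /\ ~ U x)).
Proof.
move=> liS oU iU; rewrite (measure_closed liS (Y := fun x => ~ U x) oU (invariantC iU)) ab_addC.
congr ab_add; apply/esym/measure_ext.
  by apply: lcinvI => //; split=> //; apply: zopen_lc.
by move=> x _; rewrite not_notE.
Qed.

(** As S has no points, S /\ S and S /\ ~ S have the same points as S, so that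
mu(S) = mu(S) + mu(S). *)
Lemma measure0 Z (S : pt Z -> Prop) : (forall x, pts x -> ~ S x) -> measure S = ab_zero.
Proof.
move=> S0; have cS : zclosed S.
  by apply/zclosed_openC; apply: zopen_ext (zopenT Z) => x /S0.
have iS : invariant (gv_act Z) S by move=> g x /S0.
have liS : lcinv S by split=> //; apply: zclosed_lc.
apply: ab_idem; rewrite [RHS](measure_closed liS cS iS).
by congr ab_add; apply: measure_ext => // x /S0; tauto.
Qed.

Lemma measure_empty Z : (forall x : pt Z, ~ pts x) -> mu Z = ab_zero.
Proof. by move=> Z0; rewrite -measureT measure0 // => x /Z0. Qed.

(** Additivity for partitions into locally closed pieces, by induction on their
number.  If P k is the intersection of F closed and U open, both invariant, then
S is cut into S /\ P k, (S /\ F) \ U and S \ F, and the last two do not meet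
P k, so that the induction hypothesis applies to them. *)
Lemma measure_cover Z (N : eqType) (r : seq N) (P : N -> pt Z -> Prop) (S : pt Z -> Prop) :
  uniq r -> (forall k, k \in r -> lcinv (P k)) ->
  (forall k l x, pts x -> k \in r -> l \in r -> P k x -> P l x -> k = l) ->
  lcinv S -> (forall x, pts x -> S x -> exists2 k, k \in r & P k x) ->
  measure S = \big[ab_add/ab_zero]_(k <- r) measure (fun x => S x /\ P k x).
Proof.
elim: r S => [|k r IH] S.
  by move=> _ _ _ _ cov; rewrite big_nil measure0 // => x Px /(cov x Px) [].
move=> /andP[kr ur] liP disj liS cov; rewrite big_cons.
have liPk : lcinv (P k) by apply: liP; rewrite inE eqxx.
have sub l : l \in r -> l \in k :: r by rewrite inE orbC => ->.
have [F [U [[cF iF] [oU iU] PFU]]] := lcinv_open_closed liPk.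
have liF : lcinv F by split=> //; apply: zclosed_lc.
have linF : lcinv (fun x => ~ F x).
  split; last exact: invariantC.
  exact: (zopen_lc (proj1 (zclosed_openC _) cF)).
have linU : lcinv (fun x => ~ U x).
  by split; [exact: (zclosed_lc oU)|apply: invariantC].
(* Cut along F, and then cut the part in F along U. *)
have three T : lcinv T -> measure T = ab_add (measure (fun x => T x /\ P k x))
    (ab_add (measure (fun x => (T x /\ F x) /\ ~ U x)) (measure (fun x => T x /\ ~ F x))).
  move=> liT; rewrite (measure_closed liT cF iF).
  rewrite (measure_open (lcinvI liT liF) oU iU) -ab_addA; congr ab_add.
  apply/esym/measure_ext; first exact: lcinvI.
  by move=> x Px; have := PFU x Px; tauto.
have IHr T : lcinv T -> (forall x, pts x -> T x -> S x /\ ~ P k x) ->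
    measure T = \big[ab_add/ab_zero]_(l <- r) measure (fun x => T x /\ P l x).
  move=> liT TS; apply: IH => //.
  - by move=> l /sub; apply: liP.
  - by move=> l l' x Px /sub kl /sub kl'; apply: disj.
  - move=> x Px Tx; have [Sx nPx] := TS x Px Tx; have [l] := cov x Px Sx.
    by rewrite inE => /orP[/eqP -> //|lr Plx]; exists l.
rewrite (three S liS); congr ab_add.
rewrite (IHr (fun x => (S x /\ F x) /\ ~ U x)); first 1 last.
- by apply: lcinvI => //; apply: lcinvI.
- by move=> x Px; have := PFU x Px; tauto.
rewrite (IHr (fun x => S x /\ ~ F x)); first 1 last.
- exact: lcinvI.
- by move=> x Px; have := PFU x Px; tauto.
rewrite -big_split /=; apply: eq_big_seq => l lr.
have liPl : lcinv (P l) by apply/liP/sub.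
have liSl : lcinv (fun x => S x /\ P l x) by apply: lcinvI.
rewrite (three _ liSl) [X in _ = ab_add X _]measure0 ?ab_add0.
  congr ab_add; apply: measure_ext.
  - by apply: lcinvI => //; apply: lcinvI => //; apply: lcinvI.
  - by move=> x _; tauto.
  - by apply: lcinvI => //; apply: lcinvI.
  - by move=> x _; tauto.
move=> x Px [[_ Plx] Pkx]; move: kr.
by rewrite (disj k l x Px _ (sub l lr) Pkx Plx) ?inE ?eqxx // lr.
Qed.

(** The only possible additive extension of mu to varieties with several
components. *)
Definition sum_comp (X : fgvar K) : A :=
  \big[ab_add/ab_zero]_(i : fg_idx X) mu (fg_comp i).

(** Hence sum_comp only depends on the pieces of a partition, which is what an
equivalence of varieties with finite groups actions preserves. *)
Lemma sum_comp_part (X : fgvar K) (N : finType) (P : fgpartition X N) :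
  sum_comp X = \big[ab_add/ab_zero]_(k : N) mu (piece P k).
Proof.
have pieceP k i : part_idx P k = i -> lcinv (part_set P k : pt (fg_comp i) -> Prop)
    /\ mu (piece P k) = measure (part_set P k : pt (fg_comp i) -> Prop).
  case: i /; split; first by split; [exact: part_lc|exact: part_inv].
  by rewrite (measureE (part_lc P k) (@part_inv _ _ _ P k)).
rewrite (partition_big (part_idx P) predT) //=; apply: eq_bigr => i _.
pose S k : pt (fg_comp i) -> Prop := part_set P k.
pose r := [seq k <- index_enum N | part_idx P k == i].
have rP k : k \in r = (part_idx P k == i) by rewrite mem_filter mem_index_enum andbT.
rewrite -measureT (@measure_cover (fg_comp i) N r S).
- rewrite /r big_filter; apply: eq_bigr => k /eqP /pieceP [liS ->].
  apply/esym/measure_ext => // x _; rewrite /S; tauto.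
- by rewrite filter_uniq // index_enum_uniq.
- by move=> k; rewrite rP /S => /eqP /pieceP [].
- move=> k l x [Px _] _ _ Sk Sl; have [m [_ um]] := part_cover P Px.
  by rewrite -(um k Sk) -(um l Sl).
- by split; [exact: zlcT|].
- move=> x [Px Xx] _; have [k [Sk _]] := part_cover P Px; exists k => //.
  rewrite rP; apply/eqP; have [j [_ uj]] := fg_cover Px.
  by rewrite -(uj _ Xx) -(uj _ (part_sub Px Sk)).
Qed.

Lemma sum_comp_pure Z : sum_comp (pure Z) = mu Z.
Proof. by rewrite /sum_comp (big_pred1 tt) => [|[]] //; apply/mu_giso/comp_pure. Qed.

Hypothesis mu_ind : forall Z W (iota : gv_grp Z -> gv_grp W),
  is_ind iota -> mu W = mu Z.

(** The universal property of the Grothendieck group in terms of pure actions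
and of closed subvarieties only. *)
Lemma sum_comp_compat : K0compat sum_comp.
Proof.
split=> [X Y [N [P [Q PQ]]]|X Y cY iY|Z W iota ind].
- by rewrite (sum_comp_part P) (sum_comp_part Q); apply: eq_bigr => k _; apply: mu_giso.
- rewrite /sum_comp -big_split /=; apply: eq_bigr => i _.
  have cY' : @zclosed K (fg_comp i) Y by apply: zclosed_sub.
  rewrite (mu_closed cY' (iY i)).
  by congr ab_add; apply: mu_giso; giso_same; apply: regular_same => x /= [[? ?] ?].
by rewrite !sum_comp_pure; apply: mu_ind ind.
Qed.
End Additive.

(** * Induced varieties *)

Section Slices.
Variable K : closedFieldType.
Implicit Types Z W : gvar K.

(** Z embedded in W as the open subvariety sl_set, with inverse sl_out, in such
a way that W is the disjoint union of the translates of sl_set by the cosets of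
the image of iota. *)
Record slice Z W (iota : gv_grp Z -> gv_grp W) := Slice {
  sl_set : pt W -> Prop;
  sl_in : pt Z -> pt W;
  sl_out : pt W -> pt Z;
  sl_open : zopen sl_set;
  sl_in_regular : regular sl_in;
  sl_out_regular : @regular K (subvar (zopen_lc sl_open)) Z sl_out;
  sl_in_set : forall x, pts x -> sl_set (sl_in x);
  sl_inK : forall x, pts x -> sl_out (sl_in x) = x;
  sl_outK : forall w, pts w -> sl_set w -> sl_in (sl_out w) = w;
  sl_equiv : forall g x, pts x ->
    sl_in (gv_act Z g x) = gv_act W (iota g) (sl_in x);
  sl_sat : forall w, pts w -> exists h, sl_set (gv_act W h w);
  sl_stab : forall h w, pts w -> sl_set w -> sl_set (gv_act W h w) ->
    exists g, h = iota g }.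

Lemma act_invl Z g (x y : pt Z) : pts x -> gv_act Z g x = y -> gv_act Z g^-1%g y = x.
Proof. by move=> Px <-; rewrite -actM // mulVg act1. Qed.

(** The quotient map sends (h, x) to h . x.  For its universal property, near a
point w with h . w in the slice, the map v |-> (h^-1, h . v) is a regular
section of it. *)
Lemma slice_is_ind Z W (iota : gv_grp Z -> gv_grp W) :
  injective iota -> {morph iota : g h / (g * h)%g} -> slice iota -> is_ind iota.
Proof.
move=> iinj iM [T j j' oT rj rj' jT jK j'K jE sat stab].
have jP x : pts x -> pts (j x) by apply: (proj1 rj).
have j'P w : pts w -> T w -> pts (j' w) by move=> Pw Tw; apply: (proj1 rj').
split=> //; exists (fun z => gv_act W z.1 (j z.2)); split.
- apply: (@regular_finprod K _ Z W (fun h x => gv_act W h (j x))) => h.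
  exact: (regular_comp rj (act_regular _ h)).
- move=> w Pw; have [h Tw] := sat w Pw; have Phw := act_pts (gv_act W) h Pw.
  exists h^-1%g, (j' (gv_act W h w)); split; first exact: j'P.
  by rewrite /= j'K // -actM // mulVg act1.
- move=> h1 h2 x1 x2 Px1 Px2 /=; split=> [e|[g [-> ->]]]; last first.
    by rewrite jE // -actM ?mulgKV //; apply: jP.
  have e' : gv_act W (h2^-1 * h1)%g (j x1) = j x2.
    by rewrite actM ?e; [apply: act_invl => //; apply: jP|apply: jP].
  have [g eg] : exists g, (h2^-1 * h1)%g = iota g.
    by apply: (stab _ (j x1)); rewrite ?e'; auto.
  exists g; split; first by rewrite -eg invMg invgK mulgA mulgV mul1g.
  by rewrite -(jK _ Px2) -e' eg -jE // jK //; apply: act_pts.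
- by move=> h h1 x Px /=; rewrite actM //; apply: jP.
move=> V f rf; apply: regular_cover => w Pw; have [h Tw] := sat w Pw.
have oU : zopen (fun v => T (gv_act W h v)).
  exact: (regular_cont (act_regular _ h) oT).
exists _, oU; split=> //.
have rh : @regular K (subvar (zopen_lc oU)) (subvar (zopen_lc oT)) (gv_act W h).
  by apply: regular_to_sub; [apply: regular_from_sub; apply: act_regular|move=> v []].
have rs : @regular K (subvar (zopen_lc oU)) (prodvar (finvar K (gv_grp W)) Z)
    (fun v => (h^-1%g, j' (gv_act W h v))).
  by apply: regular_pair; [apply: regular_finconst|apply: regular_comp rh rj'].
apply: regular_ext (regular_comp rs rf) => v [Pv Tv] /=.
by rewrite j'K //; [rewrite -actM // mulVg act1|apply: act_pts].
Qed.

(** The slice is the image of {1} x Z.  The universal property provides a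
regular section of the quotient map; its first component takes finitely many
values, whence the slice is open, and its second component, corrected by an
element of the group of Z, is the inverse of the embedding.  The point of W is
needed since an empty W may have elements outside of its set of points while Z
has none, and then no map sl_out exists. *)
Lemma is_ind_slice Z W (iota : gv_grp Z -> gv_grp W) (w0 : pt W) :
  pts w0 -> is_ind iota -> inhabited (slice iota).
Proof.
move=> Pw0 [iinj iM [pi [rpi sur fib equ univ]]].
have iV g : iota g^-1%g = (iota g)^-1%g.
  by apply: (mulIg (iota g)); rewrite -iM !mulVg (iota1 iM).
have [h0 [x0 [Px0 _]]] := sur w0 Pw0.
have Ppi h x : pts x -> pts (pi (h, x)) by move=> Px; apply: (proj1 rpi).
have rpih h : regular (fun x : pt Z => pi (h, x)).
  exact: (regular_comp (regular_pair (@regular_finconst K _ Z h) (regular_id Z)) rpi).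
(* A set-theoretic section s of pi becomes regular once cnorm moves its first *)
(* component to the chosen representative of its coset: cnorm is constant on  *)
(* the fibres of pi, so that regularity descends along pi by univ.            *)
have /choice [s hs] (w : pt W) : exists hx : gv_grp W * pt Z,
    pts w -> pts hx.2 /\ pi hx = w.
  have [/sur [h [x [Px e]]]|nw] := pselect (pts w); first by exists (h, x).
  by exists (h0, x0).
pose sg w := cnorm iM (s w).
have rsg : @regular K W (prodvar (finvar K (gv_grp W)) Z) sg.
  apply: univ; apply: regular_ext (cnorm_regular iM) => -[h x] [_ Px].
  have [Psx e] := hs _ (Ppi h x Px); rewrite /sg.
  case: (s (pi (h, x))) Psx e => h' x' /= Px' e.
  have [g [-> ->]] := (fib h' h x' x Px' Px).1 e.
  by rewrite cnorm_eq.
have sgP w : pts w -> pts (sg w).2 by move=> Pw; apply: (proj1 rsg w Pw).2.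
have sgK w : pts w -> pi ((sg w).1, (sg w).2) = w.
  move=> Pw; have [Ps e] := hs w Pw; rewrite -[RHS]e /sg.
  case: (s w) Ps {e} => h x /= Px; apply/esym/fib => //; first exact: act_pts.
  by exists (cgam iM h); rewrite -cgamE.
pose ginv h : gv_grp Z := odflt 1%g [pick g | iota g == h].
have ginvK g : ginv (iota g) = g.
  rewrite /ginv; case: pickP => [k /eqP /iinj //|/(_ g)]; by rewrite eqxx.
have pi1 g x : pts x -> pi (1%g, gv_act Z g x) = pi (iota g, x).
  move=> Px; apply/esym/fib => //; first exact: act_pts.
  by exists g; rewrite mulgV.
pose T w := exists g, (sg w).1 = iota g.
pose j' w := gv_act Z (ginv (sg w).1) (sg w).2.
have j'K w : pts w -> T w -> pi (1%g, j' w) = w.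
  move=> Pw [g eg]; rewrite /j' pi1; last exact: sgP.
  by rewrite eg ginvK -eg sgK.
have Tpi x : pts x -> T (pi (1%g, x)) /\ j' (pi (1%g, x)) = x.
  move=> Px; have Pw := Ppi 1%g x Px.
  have [g [eg ex]] := (fib _ _ _ _ Px (sgP _ Pw)).1 (esym (sgK _ Pw)).
  have eg' : (sg (pi (1%g, x))).1 = iota g^-1%g by rewrite eg mul1g iV.
  split; first by exists g^-1%g.
  by rewrite /j' eg' ginvK ex; apply: act_invl.
have rj' : @regular K W Z j'.
  exact: (regular_comp rsg (@regular_finprod K _ Z Z
    (fun h x => gv_act Z (ginv h) x) (fun h => act_regular _ _))).
have oT : zopen T.
  exact: (regular_cont (regular_comp rsg (regular_fst _ _))
           (zopen_fin K (fun h : gv_grp W => exists g, h = iota g))).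
constructor; apply: (@Slice Z W iota T (fun x => pi (1%g, x)) j' oT).
- exact: rpih.
- exact: (regular_from_sub _ rj').
- by move=> x Px; case: (Tpi x Px).
- by move=> x Px; case: (Tpi x Px).
- exact: j'K.
- by move=> g x Px; rewrite pi1 // -equ // mulg1.
- move=> w /sur [h [x [Px <-]]]; exists h^-1%g.
  by rewrite -equ // mulVg; case: (Tpi x Px).
- move=> h w Pw Tw Thw; have Phw := act_pts (gv_act W) h Pw.
  have Px : pts (j' w) := act_pts (gv_act Z) _ (sgP _ Pw).
  have Py : pts (j' (gv_act W h w)) := act_pts (gv_act Z) _ (sgP _ Phw).
  have e : pi (h, j' w) = pi (1%g, j' (gv_act W h w)).
    by rewrite j'K // -{2}(j'K w Pw Tw) -equ // mulg1.
  have [g [eg _]] := (fib _ _ _ _ Px Py).1 e; exists g.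
  by rewrite -[LHS](mulgKV (iota g)) -eg mul1g.
Qed.
End Slices.

(** * Powers of varieties with pure actions *)

Section WreathMap.
Variables (G H : finGroupType) (phi : G -> H) (n : nat).

Definition wreath_map (w : wreath G n) : wreath H n :=
  Wreath [ffun i => phi (wr_fun w i)] (wr_perm w).

Lemma wreath_mapM : {morph phi : g h / (g * h)%g} ->
  {morph wreath_map : u v / (u * v)%g}.
Proof.
move=> phiM u v; rewrite /wreath_map; congr Wreath.
by apply/ffunP => i; rewrite !ffunE /= phiM.
Qed.

Lemma wreath_map_inj : injective phi -> injective wreath_map.
Proof.
move=> inj_phi [f s] [g t] [/ffunP fg ->]; congr Wreath.
by apply/ffunP => i; apply: inj_phi; have := fg i; rewrite !ffunE.
Qed.
End WreathMap.

Lemma wreath_mapK (G H : finGroupType) (phi : G -> H) (psi : H -> G) n :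
  cancel phi psi -> cancel (@wreath_map G H phi n) (@wreath_map H G psi n).
Proof.
move=> phiK [f s]; rewrite /wreath_map /=; congr Wreath.
by apply/ffunP => i; rewrite !ffunE phiK.
Qed.

Section Powers.
Variable K : closedFieldType.
Implicit Types (X Y : qpvar K) (Z W : gvar K).

Lemma regular_powmap X Y (f : pt X -> pt Y) n :
  regular f -> @regular K (powvar X n) (powvar Y n) (fun x i => f (x i)).
Proof.
move=> rf; apply: (@regular_tuple K (powvar X n) Y n (fun i x => f (x i))) => i.
exact: (regular_comp (regular_proj X i) rf).
Qed.

Lemma giso_gpow Z W n : giso Z W -> giso (gpow Z n) (gpow W n).
Proof.
move=> [phi [f [f' [[[psi phiK psiK] phiM] [rf rf'] fK f'K fE]]]].
exists (@wreath_map _ _ phi n), (fun x i => f (x i)), (fun x i => f' (x i)); split.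
- split; last exact: wreath_mapM.
  by exists (@wreath_map _ _ psi n); apply: wreath_mapK.
- by split; apply: regular_powmap.
- by move=> x Px; apply: funext => i; apply: fK.
- by move=> x Px; apply: funext => i; apply: f'K.
- move=> w x Px; apply: funext => i; rewrite /= /gpow_fun /= ffunE.
  by apply: fE.
Qed.

Lemma giso_gpow0 Z : giso (gpow Z 0) (gpoint K).
Proof.
have eqw (u v : wreath (gv_grp Z) 0) : u = v.
  case: u v => [f s] [g t]; congr Wreath; first by apply/ffunP => -[].
  by apply/permP => -[].
have x0 : 'I_0 -> pt Z by case.
exists (fun=> 1%g), (fun=> tt), (fun=> x0); split.
- split; last by move=> u v; rewrite [RHS]ord1 [LHS]ord1.
  by exists (fun=> 1%g) => [u|g]; [apply: eqw|rewrite [RHS]ord1 [LHS]ord1].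
- split; first exact: (@regular_finconst K unit (powvar Z 0) tt).
  by apply: (@regular_tuple K (finvar K unit) Z 0 (fun i _ => x0 i)) => -[].
- by move=> x _; apply: funext => -[].
- by case.
- by move=> g x _.
Qed.

Lemma giso_gpow1 Z : giso (gpow Z 1) Z.
Proof.
have perm1E (s : 'S_1) : s = 1%g by apply/permP => i; rewrite [LHS]ord1 [RHS]ord1.
exists (fun w => wr_fun w ord0), (fun x => x ord0), (fun z _ => z); split.
- split; last by move=> u v; rewrite /= ffunE (perm1E (wr_perm u)) perm1.
  exists (fun g => Wreath [ffun=> g] 1%g) => [[f s]|g] /=; last by rewrite ffunE.
  by rewrite (perm1E s); congr Wreath; apply/ffunP => i; rewrite (ord1 i) ffunE.
- split; first exact: regular_proj.
  by apply: (@regular_tuple K Z Z 1 (fun _ z => z)) => i; apply: regular_id.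
- by move=> x _; apply: funext => i; rewrite (ord1 i).
- by [].
- by move=> w x Px; rewrite /= /gpow_fun (perm1E (wr_perm w)) perm1.
Qed.

(** The slice of the power is the power of the slice, since the conditions on
W^n are conditions on each coordinate, up to a permutation of the coordinates. *)
Lemma slice_gpow Z W (iota : gv_grp Z -> gv_grp W) n (s : slice iota) :
  slice (Z := gpow Z n) (W := gpow W n) (@wreath_map _ _ iota n).
Proof.
case: s => T j j' oT rj rj' jT jK j'K jE sat stab.
have oTn : @zopen K (powvar W n) (fun w => forall i, T (w i)).
  by apply: zopen_all => i; apply: (regular_cont (regular_proj W i) oT).
apply: (@Slice K (gpow Z n) (gpow W n) _ (fun w => forall i, T (w i))
  (fun x i => j (x i)) (fun w i => j' (w i)) oTn).
- exact: regular_powmap.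
- apply: (@regular_tuple K (subvar (zopen_lc oTn)) Z n (fun i w => j' (w i))) => i.
  have ri : @regular K (subvar (zopen_lc oTn)) (subvar (zopen_lc oT)) (fun w => w i).
    apply: regular_to_sub; first by apply: regular_from_sub; apply: regular_proj.
    by move=> w [].
  exact: (regular_comp ri rj').
- by move=> x Px i; apply: jT.
- by move=> x Px; apply: funext => i; apply: jK.
- by move=> w Pw Tw; apply: funext => i; apply: j'K.
- by move=> g x Px; apply: funext => i; rewrite /= /gpow_fun /= ffunE; apply: jE.
- move=> w Pw; have /choice [h hT] i : exists h, T (gv_act W h (w i)) by apply: sat.
  exists (Wreath [ffun i => h i] 1%g) => i.
  by rewrite /= /gpow_fun /= ffunE perm1.
- move=> [h s] w Pw Tw Thw.
  have /choice [g hg] i : exists g, h i = iota g.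
    exact: (stab (h i) (w (s i)) (Pw _) (Tw _) (Thw i)).
  exists (Wreath [ffun i => g i] s); rewrite /wreath_map /=; congr Wreath.
  by apply/ffunP => i; rewrite !ffunE.
Qed.
End Powers.

(** * Stratification of the power of a variety with a closed subvariety *)

Section SumPerm.
Variables m p : nat.

Lemma split_lshift (a : 'I_m) : split (lshift p a) = inl a.
Proof. exact: (unsplitK (inl a)). Qed.

Lemma split_rshift (b : 'I_p) : split (rshift m b) = inr b.
Proof. exact: (unsplitK (inr b)). Qed.

Definition sum_perm_fun (s : 'S_m) (t : 'S_p) (i : 'I_(m + p)) : 'I_(m + p) :=
  match split i with inl a => lshift p (s a) | inr b => rshift m (t b) end.

Lemma sum_perm_inj s t : injective (sum_perm_fun s t).
Proof.
rewrite /sum_perm_fun => i j.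
case: (split_ordP i) => a ->; case: (split_ordP j) => b -> /eqP.
all: rewrite ?split_lshift ?split_rshift eq_shift => /eqP //.
all: by move=> /perm_inj ->.
Qed.

Definition sum_perm (s : 'S_m) (t : 'S_p) : 'S_(m + p) := perm (sum_perm_inj (s := s) (t := t)).

Lemma sum_perml s t a : sum_perm s t (lshift p a) = lshift p (s a).
Proof. by rewrite permE /sum_perm_fun split_lshift. Qed.

Lemma sum_permr s t b : sum_perm s t (rshift m b) = rshift m (t b).
Proof. by rewrite permE /sum_perm_fun split_rshift. Qed.

(** A permutation which preserves the last p indices preserves the first m ones,
because it is onto on the last ones. *)
Lemma sum_perm_exists (r : 'S_(m + p)) :
  (forall b, exists b', r (rshift m b) = rshift m b') ->
  exists s t, r = sum_perm s t.
Proof.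
move=> /choice [t tE].
have t_inj : injective t.
  by move=> b c e; apply: (@rshift_inj m p); apply: (@perm_inj _ r); rewrite !tE e.
have /choice [s sE] a : exists a', r (lshift p a) = lshift p a'.
  case: (split_ordP (r (lshift p a))) => [a' ->|b e]; first by exists a'.
  have [u _ uK] := injF_bij t_inj.
  have : r (rshift m (u b)) = r (lshift p a) by rewrite tE uK e.
  by move/perm_inj/eqP; rewrite eq_shift.
have s_inj : injective s.
  by move=> a c e; apply: (@lshift_inj m p); apply: (@perm_inj _ r); rewrite !sE e.
exists (perm s_inj), (perm t_inj); apply/permP => i.
by case: (split_ordP i) => a ->; rewrite ?sum_perml ?sum_permr permE.
Qed.
End SumPerm.

(** The permutation enumerates first the complement of A, and then A. *)
Lemma perm_sort_set m p (A : {set 'I_(m + p)}) : #|A| = p ->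
  exists s : 'S_(m + p), forall i, (s i \in A) = (m <= i).
Proof.
move=> cA; have cA' : #|~: A| = m.
  by apply/eqP; rewrite -(eqn_add2r #|A|) addnC cardsC card_ord cA.
pose e := enum (~: A) ++ enum A.
have se : size e = m + p by rewrite size_cat -!cardE cA cA'.
have ue : uniq e.
  rewrite cat_uniq !enum_uniq andbT /=; apply/hasPn => i.
  by rewrite !mem_enum inE negbK.
pose s (i : 'I_(m + p)) := nth i e i.
have s_inj : injective s.
  move=> i j; rewrite /s (set_nth_default i) ?se // => /eqP.
  by rewrite nth_uniq ?se // => /eqP /val_inj.
exists (perm s_inj) => i; rewrite permE /s nth_cat -cardE cA'.
case: ltnP => [lt_im|le_mi].
  have : nth i (enum (~: A)) i \in enum (~: A) by rewrite mem_nth // -cardE cA'.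
  by rewrite mem_enum inE => /negbTE.
by rewrite -mem_enum mem_nth // -cardE cA ltn_subLR.
Qed.

Section WreathSum.
Variables (G : finGroupType) (m p : nat).

Definition wreath_sum (uv : wreath G m * wreath G p) : wreath G (m + p) :=
  Wreath [ffun i => match split i with inl a => wr_fun uv.1 a | inr b => wr_fun uv.2 b end]
    (sum_perm (wr_perm uv.1) (wr_perm uv.2)).

Lemma wreath_sumM : {morph wreath_sum : u v / (u * v)%g}.
Proof.
move=> u v; rewrite /wreath_sum; congr Wreath; last first.
  by apply/permP => i; case: (split_ordP i) => a ->;
    rewrite permM ?sum_perml ?sum_permr permM.
apply/ffunP => i; rewrite !ffunE /=.
by case: (split_ordP i) => a ->;
  rewrite ?sum_perml ?sum_permr ?split_lshift ?split_rshift ffunE.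
Qed.

Lemma wreath_sum_inj : injective wreath_sum.
Proof.
move=> [[f s] [f' s']] [[g t] [g' t']] [/ffunP fg /permP st].
congr (Wreath _ _, Wreath _ _).
- by apply/ffunP => a; have := fg (lshift p a); rewrite !ffunE split_lshift.
- by apply/permP => a; have /eqP := st (lshift p a); rewrite !sum_perml eq_shift => /eqP.
- by apply/ffunP => a; have := fg (rshift m a); rewrite !ffunE split_rshift.
- by apply/permP => a; have /eqP := st (rshift m a); rewrite !sum_permr eq_shift => /eqP.
Qed.
End WreathSum.

Section PowerStrata.
Variables (K : closedFieldType) (Z : gvar K) (Y : pt Z -> Prop).
Hypotheses (cY : zclosed Y) (iY : invariant (gv_act Z) Y).
Let oN : zopen (fun x => ~ Y x) := proj1 (zclosed_openC Y) cY.
Let iN : invariant (gv_act Z) (fun x => ~ Y x) := invariantC iY.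

Definition outset n (x : 'I_n -> pt Z) : {set 'I_n} := [set i | `[< ~ Y (x i) >]].

Definition stratum n (p : nat) (x : 'I_n -> pt Z) : Prop := #|outset x| = p.

Lemma outsetP n (x : 'I_n -> pt Z) i : reflect (~ Y (x i)) (i \in outset x).
Proof. by rewrite inE; apply: asboolP. Qed.

(** Having at least p coordinates outside of the closed set Y is an open
condition: it persists as long as these coordinates remain outside of Y. *)
Lemma zopen_outset n p : @zopen K (powvar Z n) (fun x => p <= #|outset x|).
Proof.
apply: zopen_local => x Px px.
exists (fun w => forall i, i \in outset x -> ~ Y (w i)); split.
- apply: zopen_all => i; have [xi|nxi] := boolP (i \in outset x).
    by apply: zopen_ext (regular_cont (regular_proj Z i) oN) => w _; split=> // /(_ isT).
  by apply: zopen_ext (zopenT (powvar Z n)) => w _; split=> // _ xi; case/negP: nxi.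
- by move=> i /outsetP.
move=> w _ xw; apply: leq_trans px _; apply: subset_leq_card.
by apply/subsetP => i /xw /outsetP.
Qed.

Lemma gact_inv_iff g x : pts x -> (Y (gv_act Z g x) <-> Y x).
Proof.
move=> Px; split=> [Ygx|]; last exact: iY.
rewrite -(act1 (gv_act Z) Px) -(mulVg g) actM //.
by apply: iY => //; apply: act_pts.
Qed.

Lemma outset_act n (w : wreath (gv_grp Z) n) (x : pt (powvar Z n)) : pts x ->
  outset (gpow_fun w x) = wr_perm w @^-1: outset x.
Proof.
move=> Px; apply/setP => i; rewrite !inE; apply: asbool_equiv_eq.
by rewrite /gpow_fun gact_inv_iff.
Qed.

Lemma stratum_lc n p : @zlc K (powvar Z n) (stratum p).
Proof.
exists (fun x => ~ (p < #|outset x|)), (fun x => p <= #|outset x|); split.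
- apply/zclosed_openC; apply: zopen_ext (zopen_outset n p.+1) => x _.
  by rewrite not_notE.
- exact: zopen_outset.
move=> x _; rewrite /stratum; split=> [->|[/negP]]; first by rewrite ltnn.
by rewrite -leqNgt => ? ?; apply/eqP; rewrite eqn_leq; apply/andP.
Qed.

Lemma stratum_inv n p : invariant (gv_act (gpow Z n)) (stratum p).
Proof.
move=> w x Px; rewrite /stratum /= outset_act // card_preimset //.
exact: perm_inj.
Qed.

Section StratumSlice.
Variables m p : nat.
Let A := gpow (gsub (zclosed_lc cY) iY) m.
Let B := gpow (gsub (zopen_lc oN) iN) p.
Let S : gvar K := @gsub K (gpow Z (m + p)) _ (stratum_lc (m + p) p) (@stratum_inv (m + p) p).

Let rset : {set 'I_(m + p)} := [set rshift m b | b : 'I_p].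

Let card_rset : #|rset| = p.
Proof. by rewrite card_imset ?card_ord //; apply: rshift_inj. Qed.

Let mem_rset i : (i \in rset) = (m <= i).
Proof.
apply/imsetP/idP => [[b _ ->]|]; first by rewrite leq_addr.
case: (split_ordP i) => a -> /=; last by exists a.
by rewrite leqNgt ltn_ord.
Qed.

Definition stratum_cat (z : pt (prodvar A B)) : pt S :=
  fun i => match split i with inl a => z.1 a | inr b => z.2 b end.

Definition stratum_split (w : pt S) : pt (prodvar A B) :=
  (fun a => w (lshift p a), fun b => w (rshift m b)).

(** Within the stratum, this forces the first m coordinates to be in Y. *)
Definition sorted_stratum (w : pt S) : Prop := forall b, ~ Y (w (rshift m b)).

Let sorted_outset w : pts w -> sorted_stratum w -> outset w = rset.
Proof.
move=> [Pw Sw] sw; apply/esym/eqP; rewrite eqEcard card_rset Sw leqnn andbT.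
by apply/subsetP => i /imsetP [b _ ->]; apply/outsetP.
Qed.

Let sorted_lshift w a : pts w -> sorted_stratum w -> Y (w (lshift p a)).
Proof.
move=> Pw sw; apply: contrapT => /(outsetP w (lshift p a)).
by rewrite sorted_outset // mem_rset /= leqNgt ltn_ord.
Qed.

Let cat_pts z : pts z -> pts (stratum_cat z) /\ sorted_stratum (stratum_cat z).
Proof.
case: z => x y [/= Px Py].
have sw : sorted_stratum (stratum_cat (x, y)).
  by move=> b; rewrite /stratum_cat split_rshift; apply: (Py b).2.
split=> //; split.
  by move=> i; rewrite /stratum_cat; case: (split i) => a; [apply: (Px a).1|apply: (Py a).1].
rewrite /stratum; apply: etrans card_rset; congr #|pred_of_set _|; apply/setP => i.
apply/outsetP/idP; rewrite mem_rset /stratum_cat; last first.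
  case: (split_ordP i) => a -> /=; first by rewrite leqNgt ltn_ord.
  by move=> _; apply: (Py a).2.
by case: (split_ordP i) => a -> /=; [move=> /(_ (Px a).2)|rewrite leq_addr].
Qed.

Lemma sorted_open : zopen sorted_stratum.
Proof.
apply: zopen_sub; apply: (@zopen_all K (powvar Z (m + p)) _ (fun b w => ~ Y (w (rshift m b)))) => b.
exact: (regular_cont (regular_proj Z (rshift m b)) oN).
Qed.

(** A coordinate permutation moves the coordinates outside of Y to the last
places, so the translates of the slice cover the stratum.  An element of the
wreath product which maps a point of the slice into the slice preserves the set
of the last p indices, because Y is invariant, so it lies in the product of the
two smaller wreath products. *)
Lemma stratum_slice : slice (Z := gprod A B) (W := S) (@wreath_sum (gv_grp Z) m p).
Proof.
apply: (@Slice K (gprod A B) S _ sorted_stratum stratum_cat stratum_split sorted_open).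
- apply: regular_to_sub; last by move=> z /cat_pts [[]].
  apply: (@regular_tuple K (prodvar A B) Z (m + p)
    (fun i z => match split i with inl a => z.1 a | inr b => z.2 b end)) => i.
  case: (split i) => a.
    exact: (regular_comp (regular_fst A B)
      (regular_of_sub (regular_proj (gsub (zclosed_lc cY) iY) a))).
  exact: (regular_comp (regular_snd A B)
    (regular_of_sub (regular_proj (gsub (zopen_lc oN) iN) a))).
- apply: regular_pair.
    apply: (@regular_tuple K (subvar (zopen_lc sorted_open)) (gsub (zclosed_lc cY) iY) m (fun a w => w (lshift p a))) => a.
    apply: regular_to_sub; last by move=> w [Pw sw]; apply: sorted_lshift.
    by do 2 apply: regular_from_sub; apply: regular_proj.
  apply: (@regular_tuple K (subvar (zopen_lc sorted_open)) (gsub (zopen_lc oN) iN) p (fun b w => w (rshift m b))) => b.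
  apply: regular_to_sub; last by move=> w [Pw sw]; apply: sw.
  by do 2 apply: regular_from_sub; apply: regular_proj.
- by move=> z /cat_pts [].
- move=> [x y] _; congr (_, _); apply: funext => i.
    by rewrite /stratum_cat split_lshift.
  by rewrite /stratum_cat split_rshift.
- move=> w _ _; apply: funext => i; rewrite /stratum_cat /stratum_split.
  by case: (split_ordP i) => a ->.
- move=> [u v] [x y] _; apply: funext => i.
  rewrite /stratum_cat /= /gpow_fun /= ffunE.
  by case: (split_ordP i) => a ->; rewrite ?sum_perml ?sum_permr ?split_lshift ?split_rshift.
- move=> w [Pw Sw]; have [s sE] := perm_sort_set Sw.
  exists (Wreath [ffun=> 1%g] s) => b; rewrite /= /gpow_fun /= ffunE act1 //.
  by apply/outsetP; rewrite sE /= leq_addr.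
move=> [f s] w Pw sw shw.
have Phw := act_pts (gv_act S) (Wreath f s) Pw.
have sR : s @^-1: rset = rset.
  rewrite -[RHS](sorted_outset Phw shw) -(sorted_outset Pw sw).
  exact/esym/(outset_act (Wreath f s) (proj1 Pw)).
have [t [t' est]] : exists t t', s = sum_perm t t'.
  apply: sum_perm_exists => b; have : rshift m b \in s @^-1: rset.
    by rewrite sR; apply: imset_f.
  by rewrite in_set => /imsetP; case => b' _ ->; exists b'.
exists (Wreath [ffun a => f (lshift p a)] t, Wreath [ffun b => f (rshift m b)] t').
rewrite est /wreath_sum /=; congr Wreath; apply/ffunP => i; rewrite ffunE.
by case: (split_ordP i) => a ->; rewrite ffunE.
Qed.

Lemma stratum_class : K0class (pure S) = cr_mul (c := K0ring K) (K0class (pure A)) (K0class (pure B)).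
Proof.
have ind := slice_is_ind (Z := gprod A B) (W := S) (@wreath_sum_inj (gv_grp Z) m p)
  (@wreath_sumM (gv_grp Z) m p) stratum_slice.
by rewrite /= K0mul_pure; apply: (K0class_ind ind).
Qed.
End StratumSlice.
End PowerStrata.

(** * The Kapranov zeta function *)

Section Kapranov.
Variable K : closedFieldType.
Implicit Types Z W : gvar K.

Lemma pure_class_closed Z (Y : pt Z -> Prop) (cY : zclosed Y) (iY : invariant (gv_act Z) Y) :
  K0class (pure Z) = ab_add (K0class (pure (gsub (zclosed_lc cY) iY)))
    (K0class (pure (gsub (zopen_lc (proj1 (zclosed_openC Y) cY)) (invariantC iY)))).
Proof.
have iY' : @fg_invariant K (pure Z) Y by move=> i g x [Px _]; apply: iY.
rewrite (K0class_closed (X := pure Z) cY iY').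
by congr ab_add; rewrite [LHS]K0class_comp (big_pred1 tt) => [|[]] //; apply: pure_giso;
  giso_same; apply: regular_same => x /= [] // [].
Qed.

Lemma kapranov_zetaE Z n : kapranov_zeta Z n = K0class (pure (gpow Z n)).
Proof. by case: n => [|n] //; apply/esym/pure_giso/giso_gpow0. Qed.

(** Taking values in a group of series makes the zeta function an additive
invariant in the sense of the general principle above. *)
Definition uzeta Z : useries_group (K0ring K) := exist _ (kapranov_zeta Z) erefl.

Lemma uzeta_giso Z W : giso Z W -> uzeta Z = uzeta W.
Proof.
move=> ZW; apply: useries_ext => n /=; rewrite !kapranov_zetaE.
exact/pure_giso/giso_gpow.
Qed.

(** The stratum of the points with p coordinates outside of Y contributes the
term of index n - p, p of the product of the two series. *)
Lemma uzeta_closed Z (Y : pt Z -> Prop) (cY : zclosed Y) (iY : invariant (gv_act Z) Y) :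
  uzeta Z = ab_add (uzeta (gsub (zclosed_lc cY) iY))
    (uzeta (gsub (zopen_lc (proj1 (zclosed_openC Y) cY)) (invariantC iY))).
Proof.
pose mu W : K0group K := K0class (pure W).
have stratum_mu m p n : m + p = n ->
    measure mu (stratum Y p : pt (gpow Z n) -> Prop)
    = cr_mul (c := K0ring K) (kapranov_zeta (gsub (zclosed_lc cY) iY) m)
        (kapranov_zeta (gsub (zopen_lc (proj1 (zclosed_openC Y) cY)) (invariantC iY)) p).
  move=> <-; rewrite !kapranov_zetaE -stratum_class.
  exact: (measureE (@pure_giso K)).
rewrite [RHS]us_mulC; apply: useries_ext => n /=.
rewrite kapranov_zetaE /psmul -[LHS](measureT (mu := mu) (@pure_giso K) (gpow Z n)).
rewrite (@measure_cover K (K0group K) mu (@pure_giso K) pure_class_closed (gpow Z n)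
  _ (index_enum _) (fun p : 'I_n.+1 => stratum Y p : pt (gpow Z n) -> Prop)).
- apply: eq_bigr => p _; rewrite cr_mulC -(@stratum_mu (n - p) p n); last first.
    by rewrite subnK // -ltnS.
  apply/esym/(measure_ext (@pure_giso K)); last by move=> x _; tauto.
  by split; [apply: stratum_lc|apply: stratum_inv].
- exact: index_enum_uniq.
- by move=> p _; split; [apply: stratum_lc|apply: stratum_inv].
- by move=> p q x _ _ _; rewrite /stratum => -> /val_inj.
- by split; first exact: zlcT.
move=> x _ _; have le_x : #|outset Y x| < n.+1 by rewrite ltnS -[n in _ <= n]card_ord max_card.
by exists (Ordinal le_x); first exact: mem_index_enum.
Qed.

(** An empty W has no slice, but then Z is empty too and both series are 1. *)
Lemma uzeta_ind Z W (iota : gv_grp Z -> gv_grp W) : is_ind iota -> uzeta W = uzeta Z.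
Proof.
move=> ind; have [iinj iM [pi [rpi sur _ _ _]]] := ind.
have [[w Pw]|W0] := pselect (exists w : pt W, pts w).
  have [s] := is_ind_slice Pw ind.
  apply: useries_ext => n /=; rewrite !kapranov_zetaE; apply: K0class_ind.
  exact: (slice_is_ind (Z := gpow Z n) (W := gpow W n) (wreath_map_inj iinj)
    (wreath_mapM iM) (slice_gpow n s)).
rewrite !(measure_empty uzeta_giso uzeta_closed) // => x Px; apply: W0.
  by exists (pi (1%g, x)); apply: (proj1 rpi).
by exists x.
Qed.

Definition kapranov_lambda (a : K0 K) : useries_group (K0ring K) :=
  K0lift (sum_comp uzeta) a.

Let uzeta_compat : K0compat (sum_comp uzeta) :=
  sum_comp_compat uzeta_giso uzeta_closed uzeta_ind.

Lemma kapranov_lambdaD a b :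
  kapranov_lambda (K0add a b) = ab_add (kapranov_lambda a) (kapranov_lambda b).
Proof. exact: (K0lift_add uzeta_compat). Qed.

Lemma kapranov_lambda_pure Z : kapranov_lambda (K0class (pure Z)) = uzeta Z.
Proof.
rewrite /kapranov_lambda (K0lift_class uzeta_compat).
exact: (sum_comp_pure uzeta_giso).
Qed.

(** The classes of pure actions generate the Grothendieck group. *)
Lemma K0_additive_ext_pure (A : abGroup) (f g : K0 K -> A) :
  (forall a b, f (K0add a b) = ab_add (f a) (f b)) ->
  (forall a b, g (K0add a b) = ab_add (g a) (g b)) ->
  (forall Z, f (K0class (pure Z)) = g (K0class (pure Z))) -> f =1 g.
Proof.
move=> fD gD fg; apply: K0_additive_ext => // X; rewrite K0class_comp.
have h0 (h : K0 K -> A) : (forall a b, h (K0add a b) = ab_add (h a) (h b)) ->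
    h (K0zero K) = ab_zero.
  by move=> hD; apply: ab_idem; rewrite -hD K0add0.
apply: (big_ind (fun x => f x = g x)) => [|x y fx fy|i _]; last exact: fg.
  by rewrite (h0 f fD) (h0 g gD).
by rewrite [LHS]fD [RHS]gD fx fy.
Qed.

Lemma kapranov_lambda1 a : sval (kapranov_lambda a) 1 = a.
Proof.
apply: (K0_additive_ext_pure (A := K0group K) (f := fun a => sval (kapranov_lambda a) 1)
  (g := id)) a => [a b|//|Z].
  by rewrite kapranov_lambdaD us_coef1_add.
rewrite kapranov_lambda_pure; exact: (pure_giso (giso_gpow1 Z)).
Qed.
End Kapranov.

Local Open Scope complex_scope.

Theorem mainTheorem2 (R : realType) :
  exists! lam : K0ring R[i] -> pseries (K0ring R[i]),
    lambda_structure lam /\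
    forall Z : gvar R[i], lam (K0class (pure Z)) = kapranov_zeta Z.
Proof.
exists (fun a => sval (kapranov_lambda a)); split.
  split=> [|Z]; last by rewrite kapranov_lambda_pure.
  split=> [a|a|a b]; [exact: (svalP (kapranov_lambda a))|exact: kapranov_lambda1|].
  by rewrite -[ab_add a b]/(K0add a b) kapranov_lambdaD.
move=> lam [[lam0 _ lamD] lamZ]; apply: funext => a.
pose ulam b : useries_group (K0ring R[i]) := exist _ (lam b) (lam0 b).
suff -> : kapranov_lambda a = ulam a by [].
apply: (K0_additive_ext_pure (A := useries_group (K0ring R[i]))) a => [a b|a b|Z].
- exact: kapranov_lambdaD.
- by apply: useries_ext => n; rewrite /= -lamD.
by rewrite kapranov_lambda_pure; apply: useries_ext => n; rewrite /= lamZ.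
Qed.
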